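(* Let $q\ge0$, $x,y\ge0$ be real with $\max\{1,q\}\,xy<1$, let $M,N\ge1$ be integers, $L=MN$, $X=(x,\dots,x)$ ($M$ entries), $Y=(y,\dots,y)$ ($N$ entries), and set $a=qxy$, $b=xy$. Let $(\mu,\lambda)$ be a random pair of strict partitions with law $$\mathbb P_q^{X,Y}(\mu,\lambda)=\frac{Q_\mu(qX)Q_{\lambda/\mu}(X)P_\lambda(Y)}{\mathsf H(qX;Y)\mathsf H(X;Y)}\quad\text{if }\mu\subseteq\lambda$$ and $0$ otherwise, and set $B=|\mu|$, $R=|\lambda|-|\mu|$. Then for $k\ge0$, $$\mathbb P(B=k)=\left(\frac{1-a}{1+a}\right)^L a^k\sum_{j=0}^{\min(L,k)}\binom{L}{j}\binom{L+k-j-1}{k-j}.$$ The mean and variance are $$\mathbb E B=\frac{2La}{1-a^2},\qquad \operatorname{Var}(B)=\frac{2La(1+a^2)}{(1-a^2)^2}.$$ The same formulas hold for $R$ after replacing $a$ by $b$.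
   Context: $|\lambda|$ is the sum of the parts of $\lambda$; $\mu\subseteq\lambda$ means $\mu_i\le\lambda_i$ for all $i$ after appending zeros. For an alphabet $A$, $p_n(A)$ is the $n$-th power sum. $A+B$ denotes the union of alphabets, so $p_n(A+B)=p_n(A)+p_n(B)$; $qX$ is the alphabet with entries multiplied by $q$. Schur $Q$- and $P$-functions are the standard ones (Macdonald, Ch. III.8): with $\sum_{r\ge0}q_r(A)z^r=\prod_{a\in A}\frac{1+az}{1-az}$, one has $Q_{(r)}=q_r$, $Q_{(r,s)}=q_rq_s+2\sum_{i\ge1}(-1)^iq_{r+i}q_{s-i}$ for $r>s\ge0$, and $Q_\lambda$ is the Pfaffian of the skew-symmetric matrix with upper entries $Q_{(\lambda_i,\lambda_j)}$, $i<j$ (a zero part is appended to $\lambda$ if its length is odd); $P_\lambda=2^{-\ell(\lambda)}Q_\lambda$. Skew $Q$-functions are determined by $Q_\lambda(A+B)=\sum_{\mu\subseteq\lambda}Q_{\lambda/\mu}(A)Q_\mu(B)$. $\mathsf H(A;B)=\exp\Big(2\sum_{n\ge1,\ n\text{ odd}}\frac{p_n(A)p_n(B)}{n}\Big)$, which for finite alphabets equals $\prod_{a\in A,b\in B}\frac{1+ab}{1-ab}$. Convention: $0^0=1$. *)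

(* Defs.v *)
From HB Require Import structures.
From mathcomp Require Import all_boot all_order all_fingroup all_algebra.
From mathcomp Require Import all_classical all_reals all_analysis.

Set Implicit Arguments.
Unset Strict Implicit.
Unset Printing Implicit Defensive.

Import Order.TTheory GRing.Theory Num.Theory.
Import numFieldNormedType.Exports.

Local Open Scope classical_set_scope.
Local Open Scope ring_scope.

Definition is_strict_partition (s : seq nat) : bool :=
  sorted gtn s && (0%N \notin s).

Record strict_partition : Type := StrictPartition {
  parts :> seq nat;
  _ : is_strict_partition parts }.

HB.instance Definition _ := [isSub for parts].
HB.instance Definition _ := [Countable of strict_partition by <:].
HB.instance Definition _ :=
  isPointed.Build strict_partition (@StrictPartition [::] isT).

HB.instance Definition _ := @isMeasurable.Build default_measure_display
  strict_partition discrete_measurable discrete_measurable0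
  discrete_measurableC discrete_measurableU.

Definition subpartition (mu lam : strict_partition) : Prop :=
  forall i, (nth 0 mu i <= nth 0 lam i)%N.

Section Functions.
Variable R : realType.
(* A finite alphabet is the sequence of its letters, so [A ++ B] is A + B. *)
Implicit Types (A B : seq R) (lam mu : strict_partition).

Definition scale_alphabet (c : R) A : seq R := [seq c * x | x <- A].

Definition power_sum (n : nat) A : R := \sum_(a <- A) a ^+ n.

(* The coefficient of z^r in \prod_(a in A) (1 + a z) / (1 - a z): it only
   depends on the geometric series 1 / (1 - a z) up to degree r. *)
Definition q_fun (r : nat) A : R :=
  (\prod_(a <- A) ((1 + a *: 'X) * \poly_(i < r.+1) a ^+ i) : {poly R})`_r.

(* Q_(r, s), meant for r > s >= 0. *)
Definition Q2 (r s : nat) A : R :=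
  q_fun r A * q_fun s A
  + 2 * \sum_(1 <= i < s.+1) (-1) ^+ i * q_fun (r + i) A * q_fun (s - i) A.

Lemma ltn_even_ord m (i : 'I_m) : (i.*2 < m.*2)%N.
Proof. by rewrite ltn_double. Qed.

Lemma ltn_odd_ord m (i : 'I_m) : (i.*2.+1 < m.*2)%N.
Proof. by rewrite ltn_Sdouble. Qed.

Definition pfaffian m (S : 'M[R]_(m.*2)) : R :=
  (2 ^+ m * m`!%:R)^-1 *
  \sum_(s : 'S_(m.*2)) (-1) ^+ s *
    \prod_(i < m) S (s (Ordinal (ltn_even_ord i))) (s (Ordinal (ltn_odd_ord i))).

(* The size is the length of lam rounded up to an even number; the default
   value of [nth] provides the appended zero part. *)
Definition Q_matrix lam A : 'M[R]_((uphalf (size lam)).*2) :=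
  \matrix_(i, j)
    if (i < j)%N then Q2 (nth 0%N lam i) (nth 0%N lam j) A
    else if (j < i)%N then - Q2 (nth 0%N lam j) (nth 0%N lam i) A
    else 0.

Definition schurQ lam A : R := pfaffian (Q_matrix lam A).

Definition schurP lam A : R := 2 ^- size lam * schurQ lam A.

Definition is_skewQ (S : strict_partition -> strict_partition -> seq R -> R) :
    Prop :=
  forall lam A B,
    schurQ lam (A ++ B) =
    \sum_(mu \in [set mu | subpartition mu lam]) S lam mu A * schurQ mu B.

(* [is_skewQ] determines [skewQ lam mu] for mu contained in lam, because the
   functions [schurQ mu] are linearly independent on finite alphabets. For other
   mu the value is unspecified. *)
Definition skewQ : strict_partition -> strict_partition -> seq R -> R :=
  xget (fun _ _ _ => 0) [set S | is_skewQ S].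

Definition cauchyH A B : R :=
  expR (2 * limn (series (fun n : nat =>
    if odd n then power_sum n A * power_sum n B / n%:R else 0))).

Definition pair_law (q : R) (X Y : seq R) mu lam : R :=
  if `[< subpartition mu lam >] then
    schurQ mu (scale_alphabet q X) * skewQ lam mu X * schurP lam Y
    / (cauchyH (scale_alphabet q X) Y * cauchyH X Y)
  else 0.

End Functions.

(* Main.v *)
Require Import Defs.
From HB Require Import structures.
From mathcomp Require Import all_boot all_order all_fingroup all_algebra.
From mathcomp Require Import all_classical all_reals all_analysis.
From mathcomp Require Import measurable_realfun.
From mathcomp Require Import ring lra zify.

(** Write H(A;Y) for the product of the (1 + a y) / (1 - a y), and u_k(c) for the
    coefficient of z^k in ((1 + c z) / (1 - c z))^L. The Cauchy identity, read degree by
    degree, says that the sum of Q_lambda(A) P_lambda(Y) over |lambda| = n is q_n of the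
    alphabet of all products a y ([cauchy_graded]). Take A = X + tX and expand
    Q_lambda(X + tX) with the skew functions: as Q_mu(tX) = t^|mu| Q_mu(X), comparing
    coefficients of t shows that the sum of Q_mu(X) Q_{lambda/mu}(X) P_lambda(Y) over
    |mu| = k and |lambda| = k + m is q_k(XY) q_m(XY) ([graded_pair_sum]). For constant X
    and Y, where XY consists of MN letters b, and after inserting q^k, the pair (B, R)
    therefore has joint law proportional to u_k(a) u_m(b). The law is a product, so both
    marginals are known up to a constant; that constant, which contains the exponential
    defining H, is forced by the total mass ([product_form_marginals]). Mean and variance
    come from (1 - c^2 z^2) f' = 2 L c f for f the generating function of the
    u_k(c), which is a three-term recursion on these coefficients ([q_fun_nseq_rec]).

    What remains is the Cauchy identity and the existence of skew functions, starting
    from Pfaffians. A strict partition with parts at most n is recorded by n bits: bit p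
    tells whether p is a part, and the head of the list is bit n. Functions of strict
    partitions are then acted on by transfer operators, which read the bits from the
    largest position down and carry one bit of memory.

    - Adding a letter a to the alphabet acts by such an operator, [down a]
      ([Q_bits_branching]). The generating function F_A(z, w) of the Q_(r,s)(A) satisfies
      (1 - a z)(1 - a w) F_{a+A} = (1 + a z)(1 + a w) F_A. Multilinearity of the Pfaffian
      in its rows turns this into hop(-a) Q(a+A) = hop(a) Q(A), where hop(c) lets every
      part decrease by at most one at cost c ([hop_Q_bits]). Bit by bit one checks
      hop(-a) down(a) = hop(a) ([hop_down]), and hop(-a) is unitriangular.
    - Since down(a) only passes to smaller partitions, iterating it over the letters of A
      exhibits the skew functions ([skewQ_exists]).
    - Let up(y) be the adjoint of down(y) for the weight 2^(-length). The two operators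
      satisfy (1 - a y) up(y) down(a) = (1 + a y) down(a) up(y) up to a term of large
      degree ([up_down_commute]), by an exchange argument of Yang-Baxter type. Applied
      letter after letter, this is the Pieri rule and then the Cauchy identity, modulo a
      power of the variable that marks the degree ([pieri_mod], [cauchy_mod]). *)

Set Implicit Arguments.
Unset Strict Implicit.
Unset Printing Implicit Defensive.

Import Order.TTheory GRing.Theory Num.Theory.
Import numFieldNormedType.Exports.

Local Open Scope classical_set_scope.
Local Open Scope ring_scope.

(** * Transfer operators on bit lists *)

Section Transfer.
Variable K : comNzRingType.
Implicit Types (a c y k : K) (f g : seq bool -> K) (b : seq bool) (s x m t : bool).

Definition topbit f m : seq bool -> K := fun b => f (m :: b).

(** [transfer w s f b] sums [f] over all lists [b'] of the length of [b], weighted by a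
    product over positions. The weight [w s x m t] belongs to a position where [b] has bit
    [x] and [b'] has bit [m], with memory [s] on entering from above and [t] on leaving
    below. The memory left at the bottom is summed over freely. *)
Fixpoint transfer (w : bool -> bool -> bool -> bool -> K) s f b : K :=
  if b is x :: b' then
      (w s x false false * transfer w false (topbit f false) b'
    + w s x false true * transfer w true (topbit f false) b')
    + (w s x true false * transfer w false (topbit f true) b'
    + w s x true true * transfer w true (topbit f true) b')
  else f [::].

Lemma eq_transfer w s f g b : (forall b', size b' = size b -> f b' = g b') ->
  transfer w s f b = transfer w s g b.
Proof.
elim: b s f g => [|x b IH] s f g fg /=; first exact: fg.
have E t m : transfer w t (topbit f m) b = transfer w t (topbit g m) b.
  by apply: IH => b' sb; apply: fg; rewrite /= sb.
by rewrite !E.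
Qed.

Lemma transferD w s f g b :
  transfer w s (fun b' => f b' + g b') b = transfer w s f b + transfer w s g b.
Proof.
elim: b s f g => [|x b IH] s f g //=; rewrite !(IH _ (topbit f _) (topbit g _)); ring.
Qed.

Lemma transferZ w s k f b :
  transfer w s (fun b' => k * f b') b = k * transfer w s f b.
Proof.
elim: b s f => [|x b IH] s f //=; rewrite !(IH _ (topbit f _)); ring.
Qed.

(** The memory is the surplus of parts of [b] over parts of [b'] seen so far; it stays in
    {0, 1} exactly when the two partitions interlace. Each position crossed with surplus
    one is a box of the skew diagram and costs [a], and each new run of such boxes costs a
    further 2: this is Q_{lambda/mu} of the single letter [a]. *)
Definition down_weight a s x m t : K :=
  match s, x, m, t with
  | false, false, false, false | false, true, true, false
  | true, false, true, false => 1
  | true, false, false, true | true, true, true, true => a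
  | false, true, false, true => 2 * a
  | _, _, _, _ => 0
  end.

(** The transpose of [down_weight] conjugated by 2^(-length): the weight loses a factor 2 at a
    position where only the larger partition has a part, and gains it where only the smaller
    one has. *)
Definition up_weight a s x m t : K :=
  match s, x, m, t with
  | false, false, false, false | false, true, true, false => 1
  | false, false, true, true | true, false, false, true
  | true, true, true, true => a
  | true, true, false, false => 2
  | _, _, _, _ => 0
  end.

(** Every part either stays or moves down by one at cost [c]; the memory says that a part is
    arriving from the position above. A part that moves down from 1 disappears. *)
Definition hop_weight c s x m t : K :=
  match s, x, m, t with
  | false, false, false, false | false, true, true, false
  | true, false, true, false => 1
  | false, true, false, true | true, true, true, true => c
  | _, _, _, _ => 0
  end.

Notation down a := (transfer (down_weight a)).
Notation up a := (transfer (up_weight a)).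
Notation hop c := (transfer (hop_weight c)).

Lemma down_consE a s x f b : down a s f (x :: b) =
  match s, x with
  | false, false => down a false (topbit f false) b
  | false, true => down a false (topbit f true) b + 2 * a * down a true (topbit f false) b
  | true, false => a * down a true (topbit f false) b + down a false (topbit f true) b
  | true, true => a * down a true (topbit f true) b
  end.
Proof. by case: s; case: x => /=; ring. Qed.

Lemma up_consE a s x f b : up a s f (x :: b) =
  match s, x with
  | false, false => up a false (topbit f false) b + a * up a true (topbit f true) b
  | false, true => up a false (topbit f true) b
  | true, false => a * up a true (topbit f false) b
  | true, true => a * up a true (topbit f true) b + 2 * up a false (topbit f false) b
  end.
Proof. by case: s; case: x => /=; ring. Qed.

Lemma hop_consE c s x f b : hop c s f (x :: b) =
  match s, x with
  | false, false => hop c false (topbit f false) b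
  | false, true => hop c false (topbit f true) b + c * hop c true (topbit f false) b
  | true, false => hop c false (topbit f true) b
  | true, true => c * hop c true (topbit f true) b
  end.
Proof. by case: s; case: x => /=; ring. Qed.

Lemma transfer_comb w w' s s' x f b :
  transfer w s (topbit (transfer w' s' f) x) b =
    (w' s' x false false * transfer w s (transfer w' false (topbit f false)) b
  + w' s' x false true * transfer w s (transfer w' true (topbit f false)) b)
  + (w' s' x true false * transfer w s (transfer w' false (topbit f true)) b
  + w' s' x true true * transfer w s (transfer w' true (topbit f true)) b).
Proof. by rewrite /topbit /= !(transferD, transferZ). Qed.

(** Packages an identity that is a linear combination of two known ones, so that [ring] can
    check it once the coefficients are supplied. *)
Lemma eq_lincomb c d l r l' r' A B : l = r -> l' = r' ->
  A - B = c * (l - r) + d * (l' - r') -> A = B :> K.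
Proof. by move=> -> -> /eqP; rewrite !subrr !mulr0 addr0 subr_eq0 => /eqP. Qed.

(** Only the difference of the two memories is conserved when the operators are composed, so
    [up false (down false)] and [up true (down true)] mix. The two combinations
    in the first equations keep their form from one position to the next. Each equation at a
    position uses several of the equations below it, so they are proved together. *)
Lemma up_down_exchange a y f b :
  [/\ up y false (down a false f) b + a * y * up y true (down a true f) b =
      down a false (up y false f) b + a * y * down a true (up y true f) b,
      up y true (down a true f) b - up y false (down a false f) b =
      down a false (up y false f) b - down a true (up y true f) b,
      up y false (down a true f) b = down a true (up y false f) b &
      up y true (down a false f) b = down a false (up y true f) b].
Proof.
elim: b f => [|x b IH] f; first by split=> /=; ring.
have [I0 J0 A0 B0] := IH (topbit f false).
have [I1 J1 A1 B1] := IH (topbit f true).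
split; case: x; rewrite !(up_consE, down_consE) !transfer_comb /=.
- apply: (eq_lincomb (c := 1 + a * y) (d := - (a * y)) I1 J1); rewrite ?A0 ?A1 ?B0 ?B1; ring.
- apply: (eq_lincomb (c := 1 + a * y) (d := a * y) I0 J0); rewrite ?A0 ?A1 ?B0 ?B1; ring.
- apply: (eq_lincomb (c := 1) (d := 0) I1 I1); rewrite ?A0 ?A1 ?B0 ?B1; ring.
- apply: (eq_lincomb (c := -1) (d := 0) I0 I0); rewrite ?A0 ?A1 ?B0 ?B1; ring.
- rewrite A1; ring.
- apply: (eq_lincomb (c := 1) (d := 0) I1 I1); rewrite ?A0 ?A1 ?B0 ?B1; ring.
- apply: (eq_lincomb (c := 2) (d := 0) I0 I0); rewrite ?A0 ?A1 ?B0 ?B1; ring.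
- rewrite B0; ring.
Qed.

(** The last term collects the configurations where a part crosses the top of the window of
    positions; it has the full degree of the window. *)
Lemma up_down_commute a y f b :
  (1 - a * y) * up y false (down a false f) b =
  (1 + a * y) * down a false (up y false f) b
  - 2 * (a * y) * up y true (down a true f) b.
Proof.
have [I J _ _] := up_down_exchange a y f b.
by apply: (eq_lincomb (c := 1) (d := a * y) I J); ring.
Qed.

(** [down a] is the quotient of [hop a] by [hop (- a)], checked position by position. The
    companion statement with an arriving part makes the induction close. *)
Lemma hop_down a f b :
  hop (- a) false (down a false f) b = hop a false f b /\
  2 * hop (- a) false (down a true f) b - hop (- a) true (down a false f) b
    = hop a true f b.
Proof.
elim: b f => [|x b IH] f; first by split=> /=; ring.
have [A0 B0] := IH (topbit f false); have [A1 B1] := IH (topbit f true).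
split; case: x; rewrite !hop_consE !transfer_comb /= -?A0 -?A1 -?B0 -?B1; ring.
Qed.

(** [hop c] is unitriangular for containment of partitions. *)
Lemma hop_inj c f g n :
  (forall b, size b = n -> hop c false f b = hop c false g b) ->
  forall b, size b = n -> f b = g b.
Proof.
elim: n f g => [|n IH] f g fg [|x b] // sb; first exact: (fg [::]).
have E0 : forall b, size b = n -> f (false :: b) = g (false :: b).
  apply: (IH (topbit f false) (topbit g false)) => b' sb'.
  have := fg (false :: b') (congr1 S sb').
  by rewrite !hop_consE.
case: sb => sb; case: x; last exact: E0.
apply: (IH (topbit f true) (topbit g true)) sb => b' sb'.
have := fg (true :: b') (congr1 S sb'); rewrite !hop_consE.
rewrite (@eq_transfer _ true (topbit f false) (topbit g false)).
  exact: addIr.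
by move=> b'' e; apply: E0; rewrite e.
Qed.

(** The bilinear form on functions of partitions with parts at most [n] that gives weight
    [h ^ length] to each; with [h] one half it turns products of two Q into Q times P. *)
Fixpoint pairing (h : K) n f g : K :=
  if n is n'.+1 then
    pairing h n' (topbit f false) (topbit g false)
    + h * pairing h n' (topbit f true) (topbit g true)
  else f [::] * g [::].

Lemma eq_pairing h n f g f' g' : (forall b, size b = n -> f b = f' b) ->
  (forall b, size b = n -> g b = g' b) -> pairing h n f g = pairing h n f' g'.
Proof.
elim: n f g f' g' => [|n IH] f g f' g' ff gg /=; first by rewrite ff // gg.
by congr (_ + _ * _); apply: IH => b sb; rewrite /topbit ?ff ?gg //= sb.
Qed.

Lemma pairingDl h n f f' g :
  pairing h n (fun b => f b + f' b) g = pairing h n f g + pairing h n f' g.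
Proof.
elim: n f f' g => [|n IH] f f' g /=; first by ring.
by rewrite !(IH (topbit f _) (topbit f' _)); ring.
Qed.

Lemma pairingZl h n k f g :
  pairing h n (fun b => k * f b) g = k * pairing h n f g.
Proof.
elim: n f g => [|n IH] f g /=; first by ring.
by rewrite !(IH (topbit f _)); ring.
Qed.

Lemma pairingC h n f g : pairing h n f g = pairing h n g f.
Proof. by elim: n f g => [|n IH] f g /=; rewrite ?(IH _ (topbit g _)) // mulrC. Qed.

Lemma pairing_transfer h n w s x f g :
  pairing h n (topbit (transfer w s f) x) g =
   (w s x false false * pairing h n (transfer w false (topbit f false)) g
  + w s x false true * pairing h n (transfer w true (topbit f false)) g)
  + (w s x true false * pairing h n (transfer w false (topbit f true)) g
  + w s x true true * pairing h n (transfer w true (topbit f true)) g).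
Proof. by rewrite -!pairingZl -!pairingDl. Qed.

Lemma pairing_down_up h n a s f g : 2 * h = 1 ->
  pairing h n (down a s f) g = pairing h n f (up a s g).
Proof.
move=> h1; elim: n s f g => [|n IH] s f g //=.
rewrite ![pairing _ _ (topbit f _) _]pairingC !pairing_transfer !IH.
rewrite ![pairing _ _ (up _ _ _) _]pairingC.
case: s => /=.
- by apply: (eq_lincomb (c := pairing h n (topbit f true) (up a false (topbit g false)))
    (d := 0) (esym h1) h1); ring.
- by apply: (eq_lincomb (c := a * pairing h n (topbit f false) (up a true (topbit g true)))
    (d := 0) h1 h1); ring.
Qed.

Fixpoint parts_of (b : seq bool) : seq nat :=
  if b is x :: b' then (if x then cons (size b) else id) (parts_of b') else [::].

Definition bits_weight b : nat := sumn (parts_of b).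

(** With memory one at the top, a part above the window still has to come down through all
    of its positions, which accounts for the extra degree [size b]. *)
Lemma down_homogeneous c a s f b :
  down (c * a) s (fun b' => c ^+ bits_weight b' * f b') b =
  c ^+ (bits_weight b + (if s then size b else 0)) * down a s f b.
Proof.
have wf : forall b, bits_weight (false :: b) = bits_weight b by [].
have wt : forall b, bits_weight (true :: b) = ((size b).+1 + bits_weight b)%N by [].
elim: b s f => [|x b IH] s f; first by case: s.
have E0 t : down (c * a) t (topbit (fun b' => c ^+ bits_weight b' * f b') false) b =
   c ^+ (bits_weight b + (if t then size b else 0)) * down a t (topbit f false) b.
  by rewrite -IH.
have E1 t : down (c * a) t (topbit (fun b' => c ^+ bits_weight b' * f b') true) b =
   c ^+ (size b).+1 *
      (c ^+ (bits_weight b + (if t then size b else 0)) * down a t (topbit f true) b).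
  rewrite -IH -transferZ; apply: eq_transfer => b' sb.
  by rewrite /topbit wt sb exprD mulrA.
rewrite !down_consE; case: s; case: x; rewrite ?E0 ?E1 ?wt ?wf ?addn0 /= ?exprD ?exprS; ring.
Qed.

Definition vacuum b : K := (~~ has id b)%:R.

(** The Q-functions computed letter by letter, for letters in any commutative ring: the
    Cauchy identity is proved over polynomials, where [c] below marks the degree. *)
Fixpoint Q_state (A : seq K) : seq bool -> K :=
  if A is a :: A' then down a false (Q_state A') else vacuum.

Lemma Q_state_scale c A b :
  Q_state [seq c * a | a <- A] b = c ^+ bits_weight b * Q_state A b.
Proof.
elim: A b => [|a A IH] b /=.
  have [hb|hb] := boolP (has id b); first by rewrite /vacuum hb mulr0.
  suff -> : bits_weight b = 0%N by rewrite mul1r.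
  by elim: b hb => [|[] b IHb].
rewrite (@eq_transfer _ _ _ (fun b' => c ^+ bits_weight b' * Q_state A b')); last first.
  by move=> b' _; exact: IH.
by rewrite down_homogeneous addn0.
Qed.

Lemma Q_state_vacuum A n : Q_state A (nseq n false) = 1.
Proof.
have dv a f : down a false f (nseq n false) = f (nseq n false).
  by elim: n f => [|n IH] f //; rewrite down_consE -/(nseq n false) IH.
elim: A => [|a A IH] /=; last by rewrite dv.
by rewrite /vacuum has_nseq andbF.
Qed.

Lemma up_vacuum y b : up y false vacuum b = vacuum b.
Proof.
have z s b' : up y s (topbit vacuum true) b' = 0.
  rewrite (@eq_transfer _ _ _ (fun b' => 0 * vacuum b')) ?transferZ ?mul0r // => b'' _.
  by rewrite mul0r.
elim: b => [|[] b IH] //; rewrite up_consE z ?mulr0 ?addr0 //.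
Qed.

Lemma pairing_vacuum h n f : pairing h n f vacuum = f (nseq n false).
Proof.
elim: n f => [|n IH] f; first by rewrite /= mulr1.
rewrite /= (IH (topbit f false)) (@eq_pairing _ _ _ _ (topbit f true) (fun b => 0 * vacuum b)) //.
  by rewrite pairingC pairingZl mul0r mulr0 addr0.
by move=> b _; rewrite mul0r.
Qed.

(** Each letter contributes one factor by [up_down_commute]. The error is a multiple of
    [c ^ n.+1]: the operator with memory one gives [c ^ n] by homogeneity, and the
    coefficient of the error term one more [c]. *)
Lemma pieri_mod c y A n : exists r, forall b, size b = n ->
  \prod_(a <- A) (1 - c * a * y) * up y false (Q_state [seq c * a | a <- A]) b =
  \prod_(a <- A) (1 + c * a * y) * Q_state [seq c * a | a <- A] b + c ^+ n.+1 * r b.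
Proof.
elim: A => [|a A [r IH]].
  by exists (fun=> 0) => b _; rewrite !big_nil up_vacuum mulr0 addr0.
(* [D] is what is left of the error term once [c ^ n] is taken out. *)
pose D := down a true (Q_state A).
exists (fun b => (1 + c * a * y) * down (c * a) false r b
   - \prod_(a <- A) (1 - c * a * y) *
     (2 * (a * y) * up y true (fun b' => c ^+ bits_weight b' * D b') b)) => b sb.
rewrite !big_cons /= [in LHS]mulrAC up_down_commute.
have -> : up y true (down (c * a) true (Q_state [seq c * a | a <- A])) b =
   c ^+ n * up y true (fun b' => c ^+ bits_weight b' * D b') b.
  rewrite -transferZ; apply: eq_transfer => b' sb'.
  rewrite (@eq_transfer _ _ _ (fun b' => c ^+ bits_weight b' * Q_state A b')); last first.
    by move=> b'' _; exact: Q_state_scale.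
  by rewrite down_homogeneous sb' sb exprD [_ ^+ bits_weight _ * _]mulrC mulrA.
have E : \prod_(j <- A) (1 - c * j * y) *
    down (c * a) false (up y false (Q_state [seq c * a | a <- A])) b =
  \prod_(j <- A) (1 + c * j * y) * down (c * a) false (Q_state [seq c * a | a <- A]) b
    + c ^+ n.+1 * down (c * a) false r b.
  rewrite -!transferZ -transferD; apply: eq_transfer => b' sb'; rewrite IH //.
  by rewrite sb' sb.
apply: (eq_lincomb (c := 1 + c * a * y) (d := 0) E E); rewrite exprS; ring.
Qed.

Lemma cauchy_mod h c A Y n : 2 * h = 1 -> exists r,
  \prod_(y <- Y) \prod_(a <- A) (1 - c * a * y)
    * pairing h n (Q_state [seq c * a | a <- A]) (Q_state Y) =
  \prod_(y <- Y) \prod_(a <- A) (1 + c * a * y) + c ^+ n.+1 * r.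
Proof.
move=> h1; elim: Y => [|y Y [r IH]].
  by exists 0; rewrite !big_nil /= pairing_vacuum Q_state_vacuum mulr0 addr0 mul1r.
have [r' P] := pieri_mod c y A n.
rewrite !big_cons /= pairingC pairing_down_up // pairingC.
exists (\prod_(a <- A) (1 + c * a * y) * r
  + \prod_(y <- Y) \prod_(a <- A) (1 - c * a * y) * pairing h n r' (Q_state Y)).
have E : \prod_(a <- A) (1 - c * a * y) *
   pairing h n (up y false (Q_state [seq c * a | a <- A])) (Q_state Y) =
   \prod_(a <- A) (1 + c * a * y) * pairing h n (Q_state [seq c * a | a <- A]) (Q_state Y)
   + c ^+ n.+1 * pairing h n r' (Q_state Y).
  rewrite -!pairingZl -pairingDl; apply: eq_pairing => // b sb; exact: P.
apply: (eq_lincomb (c := \prod_(y <- Y) \prod_(a <- A) (1 - c * a * y))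
  (d := \prod_(a <- A) (1 + c * a * y)) E IH); ring.
Qed.

End Transfer.

Notation down a := (transfer (down_weight a)).
Notation hop c := (transfer (hop_weight c)).

(** * Pfaffians *)

Lemma sum_lift_perm (V : nmodType) n (i j : 'I_n.+1) (F : 'S_n.+1 -> V) :
  \sum_(s : 'S_n.+1 | s i == j) F s = \sum_(s : 'S_n) F (lift_perm i j s).
Proof.
rewrite (reindex (lift_perm i j)); last first.
  pose ulsf i (s : 'S_n.+1) k := odflt k (unlift (s i) (s (lift i k))).
  have ulsfK i' (s : 'S_n.+1) k: lift (s i') (ulsf i' s k) = s (lift i' k).
    rewrite /ulsf; have:= neq_lift i' k.
    by rewrite -(can_eq (permK s)) => /unlift_some[] ? ? ->.
  have inj_ulsf: injective (ulsf i _).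
    move=> s; apply: can_inj (ulsf (s i) s^-1%g) _ => k'.
    by rewrite {1}/ulsf ulsfK !permK liftK.
  exists (fun s => perm (inj_ulsf s)) => [s _ | s].
    by apply/permP=> k'; rewrite permE /ulsf lift_perm_lift lift_perm_id liftK.
  move/(s _ =P _) => si0; apply/permP=> k.
  case: (unliftP i k) => [k'|] ->; rewrite ?lift_perm_id //.
  by rewrite lift_perm_lift -si0 permE ulsfK.
by apply: eq_bigl => s; rewrite lift_perm_id eqxx.
Qed.

Section Pfaffian.
Variable R : realType.

Section FixedSize.
Variable m : nat.
Implicit Types (S : 'M[R]_(m.*2)) (s : 'S_(m.*2)).

Definition lft (i : 'I_m) : 'I_(m.*2) := Ordinal (ltn_even_ord i).
Definition rgt (i : 'I_m) : 'I_(m.*2) := Ordinal (ltn_odd_ord i).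

Lemma lft_inj : injective lft.
Proof. by move=> i j /(congr1 val) /= e; apply: val_inj; apply: double_inj. Qed.
Lemma rgt_inj : injective rgt.
Proof. by move=> i j /(congr1 val) /= [e]; apply: val_inj; apply: double_inj. Qed.
Lemma lft_neq_rgt i j : lft i != rgt j.
Proof. by apply/eqP => /(congr1 (odd \o val)) /=; rewrite !odd_double. Qed.

Lemma rgt_neq_lft i j : rgt i != lft j.
Proof. by rewrite eq_sym lft_neq_rgt. Qed.

Lemma lft_rgt (k : 'I_(m.*2)) : exists i, k = lft i \/ k = rgt i.
Proof.
have h : (k./2 < m)%N by rewrite ltn_half_double.
exists (Ordinal h); have := odd_double_half k.
by case: (odd k) => /= e; [right|left]; apply: val_inj; rewrite /= -[in LHS]e.
Qed.

Definition pf_term S s : R := (-1) ^+ s * \prod_(i < m) S (s (lft i)) (s (rgt i)).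

Lemma pfaffianE S : pfaffian S = (2 ^+ m * m`!%:R)^-1 * \sum_s pf_term S s.
Proof. by []. Qed.

Lemma pfaffian_row_linear S S1 S2 (k : 'I_(m.*2)) c :
  (forall i j, i != k -> j != k -> S i j = S1 i j /\ S i j = S2 i j) ->
  (forall j, S k j = S1 k j + c * S2 k j) ->
  (forall i, S i k = S1 i k + c * S2 i k) ->
  pfaffian S = pfaffian S1 + c * pfaffian S2.
Proof.
move=> E Er Ec; rewrite !pfaffianE [c * (_ * _)]mulrCA -mulrDr.
congr (_ * _); rewrite mulr_sumr -big_split /=; apply: eq_bigr => s _.
rewrite /pf_term [c * (_ * _)]mulrCA -mulrDr; congr (_ * _).
have [i ki] := lft_rgt (s^-1%g k).
have off j : j != i -> (s (lft j) != k) && (s (rgt j) != k).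
  move=> ji; apply/andP; split; apply/eqP => e.
  - case: ki; rewrite -e permK; first by move/lft_inj => ej; rewrite ej eqxx in ji.
    by move=> e'; move: (lft_neq_rgt j i); rewrite e' eqxx.
  - case: ki; rewrite -e permK; last by move/rgt_inj => ej; rewrite ej eqxx in ji.
    by move=> e'; move: (lft_neq_rgt i j); rewrite e' eqxx.
rewrite [X in X = _](bigD1 i) //= [X in _ = X + _](bigD1 i) //= [X in _ = _ + _ * X](bigD1 i) //=.
have -> : \prod_(j < m | j != i) S (s (lft j)) (s (rgt j)) =
   \prod_(j < m | j != i) S1 (s (lft j)) (s (rgt j)).
  by apply: eq_bigr => j /off/andP[h h']; case: (E _ _ h h').
have -> : \prod_(j < m | j != i) S2 (s (lft j)) (s (rgt j)) =
   \prod_(j < m | j != i) S1 (s (lft j)) (s (rgt j)).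
  by apply: eq_bigr => j /off/andP[h h']; case: (E _ _ h h') => <-.
rewrite mulrA -mulrDl; congr (_ * _).
by case: ki => ki; rewrite -ki permKV.
Qed.

Lemma pfaffian_alternating S u v : u != v ->
  (forall i j, S (tperm u v i) (tperm u v j) = S i j) -> pfaffian S = 0.
Proof.
move=> uv St; rewrite pfaffianE.
suff /eqP -> : \sum_s pf_term S s == 0 by rewrite mulr0.
rewrite -eqNr -sumrN; apply/eqP.
rewrite [RHS](reindex_inj (mulIg (tperm u v))) /=; apply: eq_bigr => s _.
rewrite /pf_term odd_permM odd_tperm uv signr_addb mulrN1 mulNr.
by congr (- (_ * _)); apply: eq_bigr => i _; rewrite !permM St.
Qed.

(** The Pfaffian sum is over ordered lists of ordered pairs. This lemma and the next say that
    neither ordering matters, which is why any position can be chosen for a given row. *)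
Lemma pf_term_block_swap S s i j :
  pf_term S (tperm (lft i) (lft j) * tperm (rgt i) (rgt j) * s)%g = pf_term S s.
Proof.
rewrite /pf_term !odd_permM !odd_tperm (inj_eq lft_inj) (inj_eq rgt_inj) addbb /=.
congr (_ * _); rewrite [RHS](reindex_inj (@perm_inj _ (tperm i j))) /=.
apply: eq_bigr => k _; rewrite !permM.
have -> : tperm (lft i) (lft j) (lft k) = lft (tperm i j k).
  by rewrite inj_tperm //; apply: lft_inj.
have -> : tperm (lft i) (lft j) (rgt k) = rgt k by rewrite tpermD ?lft_neq_rgt.
have -> : tperm (rgt i) (rgt j) (rgt k) = rgt (tperm i j k).
  by rewrite inj_tperm //; apply: rgt_inj.
by rewrite (tpermD (rgt_neq_lft _ _) (rgt_neq_lft _ _)).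
Qed.

Lemma pf_term_pair_swap S s i : (forall x y, S x y = - S y x) ->
  pf_term S (tperm (lft i) (rgt i) * s)%g = pf_term S s.
Proof.
move=> Sa; rewrite /pf_term odd_permM odd_tperm lft_neq_rgt signr_addb expr1 mulN1r mulNr -mulrN.
congr (_ * _); rewrite [in LHS](bigD1 i) //= [in RHS](bigD1 i) //=.
rewrite !permM tpermL tpermR Sa mulNr opprK.
congr (_ * _); apply: eq_bigr => j ji.
have [l r] : lft j != lft i /\ rgt j != rgt i.
  by rewrite (inj_eq lft_inj) (inj_eq rgt_inj).
by rewrite !permM !tpermD ?lft_neq_rgt ?rgt_neq_lft // eq_sym.
Qed.

Lemma sum_pf_term S v k : (forall x y, S x y = - S y x) ->
  \sum_s pf_term S s = (m.*2)%:R * \sum_(s : 'S_(m.*2) | s k == v) pf_term S s.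
Proof.
move=> Sa.
have inv (t : 'S_(m.*2)) l : (forall s, pf_term S (t * s)%g = pf_term S s) ->
   \sum_(s : 'S_(m.*2) | s l == v) pf_term S s = \sum_(s : 'S_(m.*2) | s (t l) == v) pf_term S s.
  move=> it; rewrite (reindex_inj (mulgI t)); apply: eq_big => s //=.
  by rewrite permM.
have all_eq l : \sum_(s : 'S_(m.*2) | s l == v) pf_term S s =
    \sum_(s : 'S_(m.*2) | s k == v) pf_term S s.
  have to_lft l' : exists i, \sum_(s : 'S_(m.*2) | s l' == v) pf_term S s =
      \sum_(s : 'S_(m.*2) | s (lft i) == v) pf_term S s.
    have [i [->|->]] := lft_rgt l'; exists i => //.
    rewrite (inv (tperm (lft i) (rgt i))) ?tpermR // => s; exact: pf_term_pair_swap.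
  have [i ->] := to_lft l; have [j ->] := to_lft k.
  rewrite (inv _ _ (fun s => pf_term_block_swap S s i j)) permM tpermL tpermD //.
    by rewrite eq_sym lft_neq_rgt.
  by rewrite eq_sym lft_neq_rgt.
rewrite (partition_big (fun s : 'S_(m.*2) => s^-1%g v) predT) //=.
rewrite (eq_bigr (fun=> \sum_(s : 'S_(m.*2) | s k == v) pf_term S s)) => [|l _].
  by rewrite sumr_const card_ord mulr_natl.
rewrite -(all_eq l); apply: eq_bigl => s.
by apply/eqP/eqP => [<-|<-]; rewrite ?permK ?permKV.
Qed.

End FixedSize.

(** Expansion along a row with a single nonzero entry: the last row must be matched with the
    one before it, and the normalising constants 2 ^ m * m! absorb the choice of its
    position. *)
Lemma pfaffian_last_pair m (S : 'M[R]_(m.+1.*2)) (S' : 'M[R]_(m.*2)) :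
  (forall x y, S x y = - S y x) ->
  (forall x, S x (rgt ord_max) = (x == lft ord_max)%:R) ->
  (forall i j : 'I_(m.*2), S' i j =
     S (lift (rgt ord_max : 'I_(m.*2).+2) (lift ord_max i))
       (lift (rgt ord_max : 'I_(m.*2).+2) (lift ord_max j))) ->
  pfaffian S = pfaffian S'.
Proof.
move=> Sa Sv SS'; rewrite !pfaffianE (sum_pf_term (rgt ord_max) (rgt ord_max) Sa).
have -> : \sum_(s : 'S_(m.+1.*2) | s (rgt ord_max) == rgt ord_max) pf_term S s =
   \sum_s pf_term S' s.
  rewrite (@sum_lift_perm _ (m.*2).+1 (rgt ord_max) (rgt ord_max)).
  have e_lft : lft (ord_max : 'I_m.+1) = lift (rgt ord_max : 'I_(m.*2).+2) ord_max.
    by apply: val_inj; rewrite /= /bump /= leqNgt ltnS leqnn.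
  rewrite (bigID (fun s : 'S_(m.*2).+1 => s ord_max == ord_max)) /=.
  rewrite [X in _ + X]big1 ?addr0 => [|s ns]; last first.
    rewrite /pf_term big_ord_recr /= lift_perm_id Sv e_lft lift_perm_lift.
    by rewrite (inj_eq lift_inj) (negbTE ns) !mulr0.
  rewrite sum_lift_perm; apply: eq_bigr => s _.
  rewrite /pf_term odd_lift_perm odd_lift_perm !addbb /=; congr (_ * _).
  rewrite big_ord_recr /= lift_perm_id Sv e_lft lift_perm_lift lift_perm_id eqxx mulr1.
  have lift2 (k : 'I_(m.*2)) : val (lift (rgt ord_max : 'I_(m.*2).+2) (lift ord_max k)) = k.
    by rewrite /= /bump /= [(m.*2 <= k)%N]leqNgt ltn_ord leqNgt ltnS (ltnW (ltn_ord k)).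
  apply: eq_bigr => i _.
  have -> : lft (widen_ord (leqnSn m) i) = lift (rgt ord_max : 'I_(m.*2).+2) (lift ord_max (lft i)).
    by apply: val_inj; rewrite lift2.
  have -> : rgt (widen_ord (leqnSn m) i) = lift (rgt ord_max : 'I_(m.*2).+2) (lift ord_max (rgt i)).
    by apply: val_inj; rewrite lift2.
  by rewrite !lift_perm_lift -SS'.
rewrite mulrA; congr (_ * _).
rewrite factS natrM exprS -muln2 natrM.
have m0 : (m`!%:R : R) != 0 by rewrite pnatr_eq0 -lt0n fact_gt0.
have m1 : (m.+1%:R : R) != 0 by rewrite pnatr_eq0.
by field; rewrite m0 addrC natr1 m1 expf_neq0 ?pnatr_eq0.
Qed.

End Pfaffian.

(** * Pfaffians of sequences of rows *)

Lemma leq_uphalf_double n : (n <= (uphalf n).*2)%N.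
Proof.
by rewrite uphalf_half doubleD -{1}(odd_double_half n) leq_add2r; case: (odd n).
Qed.

Section UpperPfaffian.
Variable R : realType.
Implicit Types (H : nat -> nat -> R) (G : nat -> nat -> R) (r s pre : seq nat).

(** The matrix is built from its upper entries, indexed by position in the list of rows and
    not by the value of the row. So equal rows may be repeated without forcing the entry
    between them to vanish; this is what lets the value 0 be used as padding. *)
Definition skew_mx m H : 'M[R]_(m.*2) :=
  \matrix_(i, j) if (i < j)%N then H i j else if (j < i)%N then - H j i else 0.

Lemma skew_mxN m H x y : skew_mx m H x y = - skew_mx m H y x.
Proof. by rewrite !mxE; case: ltngtP => //; rewrite ?opprK ?oppr0. Qed.

Lemma eq_skew_mx m H H' : (forall i j, (i < j < m.*2)%N -> H i j = H' i j) ->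
  skew_mx m H = skew_mx m H'.
Proof.
by move=> HH; apply/matrixP => i j; rewrite !mxE; case: ltngtP => // ij;
  rewrite HH // ij ltn_ord.
Qed.

Lemma pf_skew_row_linear m H H1 H2 k c : (k < m.*2)%N ->
  (forall i j, (i < j)%N -> i != k -> j != k -> H i j = H1 i j /\ H i j = H2 i j) ->
  (forall j, (k < j < m.*2)%N -> H k j = H1 k j + c * H2 k j) ->
  (forall i, (i < k)%N -> H i k = H1 i k + c * H2 i k) ->
  pfaffian (skew_mx m H) = pfaffian (skew_mx m H1) + c * pfaffian (skew_mx m H2).
Proof.
move=> km E Er Ec; apply: (pfaffian_row_linear (k := Ordinal km)) => [i j ik jk|j|i].
- have {}ik : nat_of_ord i != k by apply: contra ik => /eqP e; apply/eqP/val_inj.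
  have {}jk : nat_of_ord j != k by apply: contra jk => /eqP e; apply/eqP/val_inj.
  rewrite !mxE; case: ltngtP => // ij.
    by have [<- <-] := E _ _ ij ik jk.
  by have [<- <-] := E _ _ ij jk ik.
- rewrite !mxE /=; case: ltngtP => kj; rewrite ?mulr0 ?addr0 //.
    by rewrite Er // kj ltn_ord.
  by rewrite Ec // mulrN opprD.
- rewrite !mxE /=; case: ltngtP => ki; rewrite ?mulr0 ?addr0 ?Ec //.
  by rewrite Er ?mulrN ?opprD // ki ltn_ord.
Qed.

Lemma pf_skew_adjacent m H k : (k.+1 < m.*2)%N -> H k k.+1 = 0 ->
  (forall i, (i < k)%N -> H i k = H i k.+1) ->
  (forall j, (k.+1 < j < m.*2)%N -> H k j = H k.+1 j) ->
  pfaffian (skew_mx m H) = 0.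
Proof.
move=> km E0 Ec Er; have km' := ltnW km.
set u := Ordinal km'; set v := Ordinal km.
have uv : u != v by rewrite -val_eqE /= neq_ltn ltnSn.
have su j : skew_mx m H u j = skew_mx m H v (tperm u v j).
  case: tpermP => [->|->|/eqP ju /eqP jv]; rewrite !mxE /= ?ltnn ?ltnSn.
  - by [].
  - by rewrite E0 ltnNge leqnSn /= oppr0.
  - have {}ju : nat_of_ord j != k by [].
    have {}jv : nat_of_ord j != k.+1 by [].
    case: (ltngtP k j) ju => // kj _.
      by rewrite ltn_neqAle eq_sym jv kj Er // ltn_ord ltn_neqAle eq_sym jv kj.
    have jk := ltn_trans kj (ltnSn k).
    by rewrite jk ltnNge (ltnW jk) /= Ec.
have sv j : skew_mx m H v j = skew_mx m H u (tperm u v j) by rewrite su tpermK.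
apply: (pfaffian_alternating uv) => i j.
case: (tpermP u v i) => [->|->|/eqP iu /eqP iv]; [by rewrite sv tpermK|by rewrite su tpermK|].
by rewrite ![skew_mx _ _ i _]skew_mxN; case: tpermP => [->|->|//];
  [rewrite su|rewrite sv]; rewrite tpermD // eq_sym.
Qed.

(** The last two rows agree except for the entry 1 between them. Splitting this entry off
    leaves a matrix with two equal rows, whose Pfaffian is 0, and one to which
    [pfaffian_last_pair] applies. *)
Lemma pf_skew_pad m H : H m.*2 m.*2.+1 = 1 ->
  (forall i, (i < m.*2)%N -> H i m.*2 = H i m.*2.+1) ->
  pfaffian (skew_mx m.+1 H) = pfaffian (skew_mx m H).
Proof.
move=> E1 Ec.
pose H1 i j := if (i == m.*2)%N && (j == m.*2.+1)%N then 0 else H i j.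
pose H2 i j := if (j == m.*2.+1)%N then (i == m.*2)%:R else H i j.
have H2m : pfaffian (skew_mx m.+1 H2) = pfaffian (skew_mx m H).
  apply: pfaffian_last_pair => [x y|x|i j]; first exact: skew_mxN.
  - have xm : (x <= m.*2.+1)%N by have := ltn_ord x.
    rewrite mxE -val_eqE /=; move: xm; rewrite leq_eqVlt => /orP[/eqP ->|xm].
      by rewrite ltnn gtn_eqF.
    by rewrite xm /H2 eqxx.
  - have lift2 (k : 'I_(m.*2)) :
        nat_of_ord (lift (rgt ord_max : 'I_(m.*2).+2) (lift ord_max k)) = k.
      by rewrite /= /bump /= [(m.*2 <= k)%N]leqNgt ltn_ord leqNgt ltnS (ltnW (ltn_ord k)).
    rewrite !mxE !lift2 /H2.
    have ne (k : 'I_(m.*2)) : (nat_of_ord k == m.*2.+1) = false.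
      by rewrite ltn_eqF // ltnS ltnW.
    by rewrite !ne.
have H1m : pfaffian (skew_mx m.+1 H1) = 0.
  apply: (@pf_skew_adjacent _ _ m.*2) => [||i im|j mj]; rewrite ?doubleS //.
  - by rewrite /H1 !eqxx.
  - by rewrite /H1 (ltn_eqF im) Ec.
  - by move: mj; rewrite doubleS !ltnS ltnNge => /andP[/negP].
rewrite (@pf_skew_row_linear _ H H1 H2 m.*2.+1 1) ?doubleS // ?H1m ?H2m ?mul1r ?add0r //.
- by move=> i j ij iv jv; rewrite /H1 /H2 (negbTE jv) andbF.
- by move=> j; rewrite !ltnS ltnNge => /andP[/negP].
- move=> i iv; rewrite /H1 /H2 eqxx andbT mul1r.
  move: iv; rewrite ltnS leq_eqVlt; case: eqP => [-> _|_ /= im]; first by rewrite E1 add0r.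
  by rewrite addr0.
Qed.

Variable G : nat -> nat -> R.
Hypotheses (G0 : G 0 0 = 1) (GS : forall n, G n.+1 n.+1 = 0).

(** Multiplication of a generating function by [1 + c z]. *)
Definition shifted c (g : nat -> R) n := g n + (if n is n'.+1 then c * g n' else 0).

Definition row_comb c (b : bool) (g : nat -> R) n := if b then shifted c g n else g n.

(** Entries between rows e_n for positions before [p] and e_n + c e_(n-1) from [p] on. *)
Definition mixed_entry F c p r i j : R :=
  row_comb c (p <= i)%N
    (fun n => row_comb c (p <= j)%N (fun k => F n k) (nth 0%N r j)) (nth 0%N r i).

Definition mixed_pf m c p r := pfaffian (skew_mx m (mixed_entry G c p r)).

Definition rows_pf r :=
  pfaffian (skew_mx (uphalf (size r)) (fun i j => G (nth 0%N r i) (nth 0%N r j))).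

Lemma row_combD c b c' (g h : nat -> R) n :
  row_comb c b (fun k => g k + c' * h k) n = row_comb c b g n + c' * row_comb c b h n.
Proof. by case: b => //; case: n => [|n]; rewrite /row_comb /shifted; ring. Qed.

Lemma row_comb0 c b (g : nat -> R) : row_comb c b g 0 = g 0%N.
Proof. by case: b => //; rewrite /row_comb /shifted addr0. Qed.

Lemma mixed_pf_row m c pre s n : (size pre < m.*2)%N ->
  mixed_pf m c (size pre) (pre ++ n.+1 :: s) =
  mixed_pf m c (size pre).+1 (pre ++ n.+1 :: s) + c * mixed_pf m c (size pre).+1 (pre ++ n :: s).
Proof.
move=> pm.
have nthE i k : i != size pre -> nth 0%N (pre ++ k :: s) i = nth 0%N (pre ++ n :: s) i.
  move=> ip; rewrite !nth_cat; case: ltnP => // pi.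
  have : (0 < i - size pre)%N by rewrite subn_gt0 ltn_neqAle eq_sym ip.
  by case: (i - size pre)%N.
have nthp k : nth 0%N (pre ++ k :: s) (size pre) = k by rewrite nth_cat ltnn subnn.
have leE i : i != size pre -> (size pre <= i)%N = (size pre < i)%N.
  by move=> ip; rewrite ltn_neqAle eq_sym ip.
apply: (pf_skew_row_linear (k := size pre)) => //.
- by move=> i j _ ip jp; rewrite /mixed_entry !leE // !(nthE _ n.+1).
- move=> j /andP[pj _]; rewrite /mixed_entry.
  have jp : j != size pre by rewrite gtn_eqF.
  by rewrite leqnn ltnn leE // !nthp !(nthE _ n.+1).
- move=> i pi; rewrite /mixed_entry.
  have ip : i != size pre by rewrite ltn_eqF.
  by rewrite leqnn ltnn leE // !nthp !(nthE _ n.+1) // -row_combD.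
Qed.

(** Two parts that collide contribute nothing; this is the exclusion rule of [hop]. *)
Lemma mixed_pf_repeat m c pre s n : ((size pre).+1 < m.*2)%N ->
  mixed_pf m c (size pre).+2 (pre ++ [:: n.+1, n.+1 & s]) = 0.
Proof.
move=> pm; set r := _ ++ _.
have r0 : nth 0%N r (size pre) = n.+1 by rewrite nth_cat ltnn subnn.
have r1 : nth 0%N r (size pre).+1 = n.+1 by rewrite nth_cat ltnNge leqnSn subSnn.
have F : ((size pre).+1 < size pre)%N = false by rewrite ltnNge leqnSn.
apply: (pf_skew_adjacent (k := size pre)) => //.
- by rewrite /mixed_entry r0 r1 F ltnn; exact: GS.
- by move=> i ip; rewrite /mixed_entry r0 r1 F ltnn.
- by move=> j _; rewrite /mixed_entry r0 r1 F ltnn.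
Qed.

(** For an even number of rows the appended 0 comes with a second, padding 0, and the entry 1
    between them removes both. Thus a part that reaches 0 just disappears, whatever the
    parity. *)
Lemma rows_pf_pad pre : rows_pf (rcons pre 0) = rows_pf pre.
Proof.
rewrite /rows_pf size_rcons.
have nthE i : nth 0%N (rcons pre 0%N) i = nth 0%N pre i.
  by rewrite nth_rcons; case: ltngtP => // h; rewrite nth_default // ?h // ltnW.
have -> : (fun i j => G (nth 0%N (rcons pre 0%N) i) (nth 0%N (rcons pre 0%N) j)) =
  (fun i j => G (nth 0%N pre i) (nth 0%N pre j)).
  by apply/funext => i; apply/funext => j; rewrite !nthE.
rewrite uphalfE /= -/(uphalf _); have := odd_double_half (size pre); rewrite uphalf_half.
case: (odd _) => /= e.
  by rewrite add1n.
have nd k : ((size pre)./2.*2 <= k)%N -> nth 0%N pre k = 0%N.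
  by move=> h; apply: nth_default; apply: leq_trans h; rewrite -[X in (X <= _)%N]e.
rewrite add0n; apply: pf_skew_pad => [|i im]; first by rewrite !nd ?leqnSn.
by rewrite [nth _ _ _.*2]nd // [nth _ _ _.*2.+1]nd ?leqnSn.
Qed.

(** Row-linearity expands the Pfaffian with all rows e_n + c e_(n-1) into a sum over the
    subsets of parts that move down; the rows are processed from the largest part on, those
    in [pre] being settled. *)
Lemma hop_rows_pf c b pre :
  hop c false (fun b' => rows_pf (pre ++ parts_of b')) b =
    mixed_pf (uphalf (size pre + size (parts_of b))) c (size pre) (pre ++ parts_of b) /\
  hop c true (fun b' => rows_pf (pre ++ parts_of b')) b =
    mixed_pf (uphalf ((size pre).+1 + size (parts_of b))) c (size pre).+1
       (pre ++ size b :: parts_of b).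
Proof.
elim: b pre => [|x b IH] pre.
  have plain p r : (size r <= p)%N -> mixed_pf (uphalf (size r)) c p r = rows_pf r.
    move=> rp; congr pfaffian; apply: eq_skew_mx => i j _; rewrite /mixed_entry.
    have E k g : row_comb c (p <= k)%N g (nth 0%N r k) = g (nth 0%N r k).
      case: leqP => // pk; rewrite nth_default ?row_comb0 //; exact: leq_trans pk.
    by rewrite E E.
  rewrite [parts_of _]/= !addn0 cats0; split; first by rewrite plain //= cats0.
  by rewrite cats1 -(size_rcons pre (size (Nil bool))) plain // rows_pf_pad /= cats0.
have C (s : bool) : hop c s (topbit (fun b' => rows_pf (pre ++ parts_of b')) true) b =
    hop c s (fun b' => rows_pf (rcons pre (size b).+1 ++ parts_of b')) b.
  by apply: eq_transfer => b' sb; rewrite /topbit /= sb cat_rcons.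
have [I0 J0] := IH pre; have [I1 J1] := IH (rcons pre (size b).+1).
have s1 n : (size pre + n.+1 = (size pre).+1 + n)%N by rewrite addnS addSn.
split; case: x; rewrite hop_consE ?C.
- rewrite I1 J0 /= size_rcons cat_rcons s1 [RHS]mixed_pf_row //.
  exact: leq_trans (leq_addr _ _) (leq_uphalf_double _).
- by rewrite I0.
- have bound : ((size pre).+1 < (uphalf ((size pre).+2 + size (parts_of b))).*2)%N.
    exact: leq_trans (leq_addr _ _) (leq_uphalf_double _).
  rewrite J1 /= size_rcons -[in RHS]cat_rcons [RHS]/=.
  rewrite s1 -(size_rcons pre (size b).+1) [RHS]mixed_pf_row; last by rewrite size_rcons.
  by rewrite size_rcons !cat_rcons mixed_pf_repeat ?add0r.
- by rewrite I1 size_rcons cat_rcons.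
Qed.

End UpperPfaffian.

(** * One more letter *)

Section QFunctions.
Variable R : realType.
Implicit Types (A B : seq R) (a c : R).

Definition letter_poly r a : {poly R} := (1 + a *: 'X) * \poly_(i < r.+1) a ^+ i.

Definition letter_coef a i : R := if i is 0 then 1 else 2 * a ^+ i.

Lemma coef_letter_poly r a i : (i <= r)%N -> (letter_poly r a)`_i = letter_coef a i.
Proof.
move=> ir; rewrite /letter_poly mulrDl mul1r -scalerAl coefD coefZ coefXM !coef_poly ltnS ir.
case: i ir => [|i] ir /=; first by rewrite mulr0 addr0.
by rewrite ltnS (ltnW ir) -exprS mulr_natl mulr2n.
Qed.

Lemma coef_letter_prod r j A : (j <= r)%N ->
  (\prod_(a <- A) letter_poly r a)`_j = q_fun j A.
Proof.
rewrite /q_fun -[in RHS]/(letter_poly j) => jr.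
suff H s i : (i <= s)%N -> (\prod_(a <- A) letter_poly s a)`_i =
    (\prod_(a <- A) letter_poly i a)`_i by rewrite H.
suff H' s' : (i <= s)%N -> (i <= s')%N -> (\prod_(a <- A) letter_poly s a)`_i =
    (\prod_(a <- A) letter_poly s' a)`_i by move=> h; rewrite (H' i).
elim: A i => [|a A IH] i is_ is'; first by rewrite !big_nil.
rewrite !big_cons !coefM; apply: eq_bigr => [[k]] /=; rewrite ltnS => ki _.
have h := leq_trans (leq_subr k i).
by rewrite !coef_letter_poly ?(leq_trans ki) // IH ?h.
Qed.

Lemma q_fun_cat n A B : q_fun n (A ++ B) = \sum_(i < n.+1) q_fun i A * q_fun (n - i) B.
Proof.
rewrite -(coef_letter_prod _ (leqnn n)) big_cat coefM; apply: eq_bigr => i _.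
by rewrite !coef_letter_prod // ?leq_subr // -ltnS.
Qed.

Lemma q_fun_nil n : q_fun n [::] = (n == 0%N)%:R :> R.
Proof. by rewrite /q_fun big_nil coef1. Qed.

Lemma q_fun_seq1 n a : q_fun n [:: a] = letter_coef a n.
Proof. by rewrite -(coef_letter_prod _ (leqnn n)) big_seq1 coef_letter_poly. Qed.

Lemma q_fun0 A : q_fun 0 A = 1.
Proof.
elim: A => [|a A IH]; first by rewrite q_fun_nil.
by rewrite -cat1s q_fun_cat big_ord1 IH q_fun_seq1 mulr1.
Qed.

Lemma perm_q_fun n A B : perm_eq A B -> q_fun n A = q_fun n B.
Proof. by move=> AB; rewrite /q_fun (perm_big _ AB). Qed.

Lemma q_fun_scale n c A : q_fun n (scale_alphabet c A) = c ^+ n * q_fun n A.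
Proof.
elim: A n => [|a A IH] n; first by rewrite q_fun_nil; case: n => [|n]; rewrite ?mulr0 ?mulr1.
rewrite /scale_alphabet /= -!(cat1s _ (map _ _)) -(cat1s a) !q_fun_cat mulr_sumr.
apply: eq_bigr => i _.
have -> : c ^+ n = c ^+ i * c ^+ (n - i) by rewrite -exprD subnKC // -ltnS.
rewrite (IH (n - i)%N) !q_fun_seq1.
by case: i => [[|i] ?] /=; rewrite ?exprMn /letter_coef; ring.
Qed.

(** This is (1 - a z) q_{a+A}(z) = (1 + a z) q_A(z). *)
Lemma shifted_q_fun a A n :
  shifted (- a) (fun k => q_fun k (a :: A)) n = shifted a (fun k => q_fun k A) n.
Proof.
case: n => [|n]; rewrite /shifted ?q_fun0 // -cat1s !q_fun_cat big_ord_recl /= subn0.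
rewrite q_fun_seq1 mul1r -addrA mulr_sumr -big_split /=; congr (_ + _).
rewrite big_ord_recl /= big1 ?addr0 => [|i _].
  by rewrite !q_fun_seq1 /= subn0 subSS subn0; ring.
rewrite !q_fun_seq1 /= /bump /= !add1n !subSS /= exprS. by ring.
Qed.

Lemma shifted_inj c (f g : nat -> R) : shifted c f =1 shifted c g -> f =1 g.
Proof.
move=> fg; elim=> [|n IH]; first by have := fg 0%N; rewrite /shifted !addr0.
by have := fg n.+1; rewrite /shifted IH => /addIr.
Qed.

(** The letters a and -a cancel, so this is q_A(z) q_A(-z) = 1. *)
Lemma q_fun_opposite n A : q_fun n (A ++ scale_alphabet (-1) A) = (n == 0%N)%:R.
Proof.
elim: A => [|a A IH]; first exact: q_fun_nil.
rewrite -IH (@perm_q_fun _ _ (a :: - a :: A ++ scale_alphabet (-1) A)); last first.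
  by rewrite /scale_alphabet /= mulN1r perm_cons perm_catC perm_cons perm_catC.
move: (_ ++ _) n {IH} => B; apply: (@shifted_inj (- a)) => n.
by rewrite shifted_q_fun -[X in shifted X _ _]opprK shifted_q_fun.
Qed.

(** Up to sign, the coefficient of z^(2m) in q_A(z) q_A(-z) = 1. *)
Lemma Q2_diag m A : (0 < m)%N -> Q2 m m A = 0.
Proof.
move=> m0.
have : \sum_(0 <= i < m.*2.+1) (-1) ^+ i * (q_fun i A * q_fun (m.*2 - i) A) = 0.
  have := q_fun_opposite m.*2 A; rewrite double_eq0 (gtn_eqF m0) => E0; rewrite -[RHS]E0.
  rewrite (@perm_q_fun _ (A ++ _) (scale_alphabet (-1) A ++ A)); last by rewrite perm_catC.
  by rewrite q_fun_cat big_mkord; apply: eq_bigr => i _; rewrite q_fun_scale mulrA.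
pose F i := (-1) ^+ i * q_fun (m + i) A * q_fun (m - i) A.
have lo : \sum_(0 <= i < m) (-1) ^+ i * (q_fun i A * q_fun (m.*2 - i) A)
    = (-1) ^+ m * \sum_(1 <= i < m.+1) F i.
  rewrite big_nat_rev /= add0n big_add1 /= mulr_sumr; apply: eq_big_nat => l /andP[_ lm].
  have -> : (-1) ^+ (m - l.+1) = (-1) ^+ m * (-1) ^+ l.+1 :> R.
    by rewrite -[in LHS]signr_odd oddB // signr_addb !signr_odd.
  have -> : (m.*2 - (m - l.+1) = m + l.+1)%N by move: lm; clear; lia.
  by rewrite /F; ring.
have hi : \sum_(m.+1 <= i < m.*2.+1) (-1) ^+ i * (q_fun i A * q_fun (m.*2 - i) A)
    = (-1) ^+ m * \sum_(1 <= i < m.+1) F i.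
  rewrite -[m.+1 in LHS]add1n big_addn -addnn -addSn addnK mulr_sumr.
  apply: eq_big_nat => l /andP[_ lm].
  by rewrite /F exprD subnDr addnC; ring.
rewrite (@big_cat_nat _ _ _ m 0) //=; last by rewrite leqW // -addnn leq_addr.
rewrite lo big_ltn; last by rewrite ltnS -addnn leq_addr.
rewrite hi -[in m.*2]addnn addnK => E.
have : (-1) ^+ m * Q2 m m A = 0.
  rewrite -[RHS]E /Q2 -[\sum_(1 <= i < m.+1) _]/(\sum_(1 <= i < m.+1) F i); ring.
by move/eqP; rewrite mulf_eq0 signr_eq0 => /eqP.
Qed.

(** [Q2] as a bilinear form in the two sequences of coefficients, so that each of them can be
    shifted separately. *)
Definition two_row (f g : nat -> R) r s : R :=
  f r * g s + 2 * \sum_(1 <= i < s.+1) (-1) ^+ i * f (r + i)%N * g (s - i)%N.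

Lemma two_row_shiftr c f g r s :
  shifted c (fun k => two_row f g r k) s = two_row f (shifted c g) r s.
Proof.
case: s => [|s]; rewrite /shifted /two_row.
  by rewrite !big_geq //; ring.
rewrite [in RHS]big_nat_recr //= subnn addr0 [in LHS]big_nat_recr //= subnn.
rewrite [X in _ = _ + 2 * (X + _)](eq_big_nat _ _
  (F2 := fun i => (-1) ^+ i * f (r + i)%N * g (s.+1 - i)%N
     + c * ((-1) ^+ i * f (r + i)%N * g (s - i)%N))).
  rewrite big_split /= -mulr_sumr; ring.
by move=> i /andP[_ is_]; rewrite subSn //; ring.
Qed.

Lemma two_row_shiftl c f g r s :
  shifted c (fun k => two_row f g k s) r.+1 = two_row (shifted c f) g r.+1 s.
Proof.
rewrite /shifted /two_row.
rewrite [X in _ = _ + 2 * X](eq_big_nat _ _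
  (F2 := fun i => (-1) ^+ i * f (r.+1 + i)%N * g (s - i)%N
     + c * ((-1) ^+ i * f (r + i)%N * g (s - i)%N))).
  rewrite big_split /= -mulr_sumr; ring.
by move=> i _; rewrite addSn; ring.
Qed.

Definition Q_bits A (b : seq bool) : R := rows_pf (fun r s => Q2 r s A) (parts_of b).

Lemma schurQ_bits (lam : strict_partition) A b : parts_of b = parts lam ->
  schurQ lam A = Q_bits A b.
Proof. by move=> e; rewrite /Q_bits e. Qed.

Lemma parts_of_bound b i : (nth 0%N (parts_of b) i <= size b)%N.
Proof.
elim: b i => [|x b IH] i /=; first by rewrite nth_nil.
case: x => /=; last exact: leqW.
by case: i => [|i] //=; apply: leqW.
Qed.

Lemma parts_of_decreasing b i j : (i < j)%N -> (i < size (parts_of b))%N ->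
  (nth 0%N (parts_of b) j < nth 0%N (parts_of b) i)%N.
Proof.
elim: b i j => [|[] b IH] i j //=; last exact: IH.
case: i j => [|i] [|j] //=; first by move=> _ _; rewrite ltnS parts_of_bound.
by rewrite !ltnS; exact: IH.
Qed.

(** The entries of the two Pfaffians of [hop_rows_pf] agree because both are bilinear in a
    shifted sequence of coefficients and these sequences agree by [shifted_q_fun]. Only
    entries above the diagonal matter, where the first row is positive; there no negative
    index is involved. *)
Lemma hop_Q_bits a A b :
  hop (- a) false (Q_bits (a :: A)) b = hop a false (Q_bits A) b.
Proof.
have G0 B : Q2 0 0 B = 1 by rewrite /Q2 q_fun0 big_geq // mulr0 addr0 mulr1.
have GS B n : Q2 n.+1 n.+1 B = 0 by exact: Q2_diag.
have [-> _] := @hop_rows_pf R (fun r s => Q2 r s (a :: A)) (G0 _) (GS _) (- a) b [::].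
have [-> _] := @hop_rows_pf R (fun r s => Q2 r s A) (G0 _) (GS _) a b [::].
congr pfaffian; apply: eq_skew_mx => i j /andP[ij jm].
rewrite /mixed_entry /row_comb /= add0n in jm *.
have il : (i < size (parts_of b))%N.
  rewrite ltnNge; apply/negP => h; move: (leq_ltn_trans h ij) jm.
  rewrite uphalf_half; have := odd_double_half (size (parts_of b)); lia.
have := parts_of_decreasing ij il.
case: (nth 0%N (parts_of b) i) => // r _; set s := nth _ _ j.
have E c B k : shifted c (fun n => shifted c (fun k' => Q2 n k' B) s) k.+1 =
  two_row (shifted c (fun k => q_fun k B)) (shifted c (fun k => q_fun k B)) k.+1 s.
  rewrite -two_row_shiftl; congr (shifted c _ k.+1); apply/funext => n.
  by rewrite -two_row_shiftr.
rewrite !E; congr (two_row _ _ _ _); apply/funext => n; exact: shifted_q_fun.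
Qed.

Lemma Q_bits_branching a A b : Q_bits (a :: A) b = down a false (Q_bits A) b.
Proof.
apply: (@hop_inj _ (- a) _ _ (size b)) => // b' _.
by rewrite hop_Q_bits (hop_down a (Q_bits A) b').1.
Qed.

End QFunctions.

(** * Strict partitions with bounded parts *)

Section Combinatorics.

Fixpoint allbits n : seq (seq bool) :=
  if n is n'.+1 then map (cons false) (allbits n') ++ map (cons true) (allbits n')
  else [:: [::]].

Lemma mem_allbits n b : (b \in allbits n) = (size b == n).
Proof.
elim: n b => [|n IH] [|x b] //=.
  by rewrite mem_cat; apply/negbTE; rewrite negb_or; apply/andP; split; apply/mapP => -[].
rewrite mem_cat eqSS -IH; case: x.
  rewrite orbC mem_map; last by move=> ? ? [].
  by case: (_ \in _) => //=; apply/mapP => -[].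
rewrite mem_map; last by move=> ? ? [].
by case: (_ \in _) => //=; apply/mapP => -[].
Qed.

Lemma uniq_allbits n : uniq (allbits n).
Proof.
elim: n => [|n IH] //=; rewrite cat_uniq !map_inj_uniq ?IH; try by move=> ? ? [].
rewrite andbT; apply/hasPn => _ /mapP[b _ ->]; by apply/mapP => -[].
Qed.

Lemma parts_of_inj n b c : size b = n -> size c = n -> parts_of b = parts_of c -> b = c.
Proof.
elim: n b c => [|n IH] [|x b] [|y c] //= [sb] [sc].
have no s d : size d = n -> n.+1 :: s <> parts_of d.
  by move=> sd e; have := parts_of_bound d 0; rewrite -e /= sd ltnn.
case: x y => -[] /=; rewrite ?sb ?sc.
- by case=> /IH ->.
- by move/no.
- by move/esym/no.
- by move/IH ->.
Qed.

Lemma parts_of_strict b : is_strict_partition (parts_of b).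
Proof.
have h c : sorted gtn (parts_of c) && all (fun k => 0 < k <= size c)%N (parts_of c).
  elim: c => [|[] c /andP[so al]] //=; last first.
    by rewrite so; apply: sub_all al => k /andP[-> /= ?]; apply: leqW.
  rewrite leqnn; apply/andP; split; last first.
    by apply: sub_all al => k /andP[-> /= ?]; apply: leqW.
  case: (parts_of c) so al => //= k s -> /andP[/andP[_ kc] _].
  by rewrite andbT /gtn /= ltnS.
have /andP[so al] := h b; rewrite /is_strict_partition so /=.
by apply/negP => /(allP al).
Qed.

Definition strict_of_bits b : strict_partition := StrictPartition (parts_of_strict b).

Fixpoint bits_of n (s : seq nat) : seq bool :=
  if n is n'.+1 then
    if s is k :: s' then if k == n then true :: bits_of n' s' else false :: bits_of n' s
    else false :: bits_of n' s
  else [::].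

Lemma size_bits_of n s : size (bits_of n s) = n.
Proof. by elim: n s => [|n IH] [|k s] //=; [|case: ifP => _ /=]; rewrite IH. Qed.

Lemma bits_ofK n s : is_strict_partition s -> (nth 0%N s 0 <= n)%N ->
  parts_of (bits_of n s) = s.
Proof.
elim: n s => [|n IH] [|k s] //=.
- by rewrite leqn0 /is_strict_partition => /andP[_] /[swap] /eqP ->; rewrite inE eqxx.
- by move=> _ _; rewrite IH.
move=> st kn; case: eqP => [e|/eqP ne] /=; last by rewrite IH //= -ltnS ltn_neqAle ne.
move: st; rewrite /is_strict_partition /= inE negb_or => /andP[ks /andP[_ s0]].
rewrite size_bits_of IH ?e // ?/is_strict_partition ?(path_sorted ks) ?s0 //.
by case: s ks {s0} => //= l s /andP[]; rewrite /gtn /= e ltnS.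
Qed.

Definition bounded_strict n : seq strict_partition := map strict_of_bits (allbits n).

Lemma uniq_bounded_strict n : uniq (bounded_strict n).
Proof.
rewrite map_inj_in_uniq ?uniq_allbits // => b c; rewrite !mem_allbits => /eqP sb /eqP sc.
by move/(congr1 parts) => /=; exact: parts_of_inj sb sc.
Qed.

Lemma mem_bounded_strict n (lam : strict_partition) :
  (nth 0%N lam 0 <= n)%N -> lam \in bounded_strict n.
Proof.
move=> ln; apply/mapP; exists (bits_of n lam).
  by rewrite mem_allbits size_bits_of.
by apply: val_inj; rewrite /= bits_ofK //; case: lam {ln}.
Qed.

Lemma nth_sumn (s : seq nat) i : (nth 0%N s i <= sumn s)%N.
Proof.
elim: s i => [|k s IH] [|i] //=; first exact: leq_addr.
exact: leq_trans (IH i) (leq_addl _ _).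
Qed.

Definition subparts (p r : seq nat) := forall i, (nth 0%N p i <= nth 0%N r i)%N.

Lemma subparts_trans p r s : subparts p r -> subparts r s -> subparts p s.
Proof. by move=> pr rs i; exact: leq_trans (pr i) (rs i). Qed.

Lemma subparts_cons k l p r : (k <= l)%N -> subparts p r -> subparts (k :: p) (l :: r).
Proof. by move=> kl pr [|i] /=. Qed.

Lemma sumn_subparts p r : subparts p r -> (sumn p <= sumn r)%N.
Proof.
elim: p r => [|k p IH] r pr //=; case: r pr => [|l r] pr /=.
  have k0 := pr 0%N; rewrite /= in k0.
  have pr' : subparts p [::] by move=> i; have := pr i.+1; rewrite !nth_nil.
  have := IH [::] pr' => /=.
  by move: k0; rewrite !leqn0 => /eqP -> /eqP ->.
by apply: leq_add (pr 0%N) (IH _ (fun i => pr i.+1)).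
Qed.

End Combinatorics.

(** * Existence of skew functions *)

Section Containment.
Variable K : comNzRingType.
Implicit Types (f g : seq bool -> K).

(** [down a] only uses partitions contained in the given one; with memory one, there is in
    addition an incoming part, which lands at the top position or below. *)
Lemma down_local a s f g b :
  (forall c, size c = size b ->
     subparts (parts_of c) (if s then size b :: parts_of b else parts_of b) -> f c = g c) ->
  down a s f b = down a s g b.
Proof.
elim: b s f g => [|x b IH] s f g fg.
  by apply: fg => //=; case: s => i //=; rewrite nth_nil.
have w r l : subparts r (size b :: l) -> subparts r ((size b).+1 :: l).
  by move=> h [|i]; [apply: leqW (h 0%N)|exact: h i.+1].
rewrite !down_consE; case: s fg => /=; case: x => /= fg.
- congr (_ * _); apply: IH => c sc h; apply: fg; rewrite /= ?sc //.
  by apply: subparts_cons => //; exact: w.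
- congr (_ * _ + _); apply: IH => c sc h; apply: fg; rewrite /= ?sc //.
    exact: w.
  exact: subparts_cons.
- congr (_ + _ * _); apply: IH => c sc h; apply: fg; rewrite /= ?sc //.
    exact: subparts_cons.
  exact: w.
- by apply: IH => c sc h; apply: fg; rewrite /= ?sc.
Qed.

Definition down_all (A : seq K) f : seq bool -> K := foldr (fun a f => down a false f) f A.

Lemma down_all_local A f g b :
  (forall c, size c = size b -> subparts (parts_of c) (parts_of b) -> f c = g c) ->
  down_all A f b = down_all A g b.
Proof.
elim: A b => [|a A IH] b fg /=; first by apply: fg => // i.
apply: down_local => c sc cb; apply: IH => d sd dc; apply: fg; first by rewrite sd.
exact: subparts_trans cb.
Qed.

Lemma down_all_sum A (I : Type) (r : seq I) (k : I -> K) (F : I -> seq bool -> K) b :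
  down_all A (fun c => \sum_(i <- r) k i * F i c) b =
  \sum_(i <- r) k i * down_all A (F i) b.
Proof.
elim: A b => [|a A IH] b //=.
rewrite (eq_transfer _ _ (g := fun c => \sum_(i <- r) k i * down_all A (F i) c)); last first.
  by move=> c _; rewrite IH.
elim: r {IH} => [|i r IH].
  rewrite big_nil (eq_transfer _ _ (g := fun c => 0 * vacuum K c)) ?transferZ ?mul0r //.
  by move=> c _; rewrite big_nil mul0r.
rewrite big_cons -IH -transferZ -transferD; apply: eq_transfer => c _.
by rewrite big_cons.
Qed.

End Containment.

Section SchurQ.
Variable R : realType.
Implicit Types (A B : seq R).

Lemma Q_bits_nil b : Q_bits [::] b = vacuum R b.
Proof.
have e : (~~ has id b) = (parts_of b == [::]) by elim: b => [|[] b IH].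
rewrite /vacuum e /Q_bits /rows_pf; case E : (parts_of b) => [|k s]; last first.
  rewrite [pfaffian _]/pfaffian big1 ?mulr0 // => t _.
  apply/eqP; rewrite mulf_eq0; apply/orP; right; apply/prodf_eq0.
  exists ord0 => //; rewrite mxE.
  have z i j : (i < j < (uphalf (size (k :: s))).*2)%N ->
      Q2 (nth 0%N (k :: s) i) (nth 0%N (k :: s) j) ([::] : seq R) = 0.
    move=> /andP[ij jm]; rewrite -E in jm *.
    have il : (i < size (parts_of b))%N.
      rewrite ltnNge; apply/negP => h; move: (leq_ltn_trans h ij) jm.
      rewrite uphalf_half; have := odd_double_half (size (parts_of b)); lia.
    have := parts_of_decreasing ij il; case: (nth 0%N _ i) => // n _.
    rewrite /Q2 !q_fun_nil /= mul0r add0r big1 ?mulr0 // => l _.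
    by rewrite q_fun_nil /= mulr0 mul0r.
  by case: ltngtP => // h; rewrite z ?oppr0 // h ltn_ord.
rewrite /pfaffian /= expr0 fact0 mulr1 invr1 mul1r.
rewrite (eq_bigr (fun=> 1)) => [|t _].
  by rewrite sumr_const card_Sn.
rewrite big_ord0 mulr1 (_ : t = 1%g) ?odd_perm1 //.
by apply/permP => -[].
Qed.

Lemma Q_bits_state A b : Q_bits A b = Q_state A b.
Proof.
elim: A b => [|a A IH] b /=; first exact: Q_bits_nil.
by rewrite Q_bits_branching; apply: eq_transfer => c _; exact: IH.
Qed.

Lemma Q_bits_cat A B b : Q_bits (A ++ B) b = down_all A (Q_bits B) b.
Proof.
elim: A b => [|a A IH] b //=.
by rewrite Q_bits_branching; apply: eq_transfer => c _; exact: IH.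
Qed.

(** Q_lambda(A + B) is obtained from the function mu -> Q_mu(B) by the operators [down] of the
    letters of A. Expanding that function on indicator functions gives the coefficients, and
    locality says that only mu contained in lambda occur. *)
Lemma skewQ_exists : exists S, @is_skewQ R S.
Proof.
pose delta (mu : strict_partition) (b : seq bool) : R := (parts_of b == mu)%:R.
exists (fun lam mu A => down_all A (delta mu) (bits_of (sumn lam) lam)) => lam A B.
set n := sumn lam.
have lamK : parts_of (bits_of n lam) = lam.
  by apply: bits_ofK; [case: lam @n|exact: nth_sumn].
rewrite (schurQ_bits _ lamK) Q_bits_cat.
rewrite (@down_all_local _ _ _
  (fun c => \sum_(b <- allbits n) Q_bits B b * delta (strict_of_bits b) c)); last first.
  move=> c; rewrite size_bits_of => sc _.
  rewrite (bigD1_seq c) ?uniq_allbits ?mem_allbits ?sc ?eqxx //= /delta eqxx mulr1.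
  rewrite big_seq_cond big1 ?addr0 // => b; rewrite mem_allbits => /andP[/eqP sb bc].
  case: eqP => [/(parts_of_inj sc sb) e|]; last by rewrite mulr0.
  by rewrite e eqxx in bc.
rewrite down_all_sum.
rewrite (@fsbig_fwiden _ _ _ _ (bounded_strict n)) ?uniq_bounded_strict //.
- by rewrite big_map; apply: eq_bigr => b _; rewrite mulrC.
- move=> mu /= sub; apply: mem_bounded_strict.
  exact: leq_trans (sub 0%N) (nth_sumn _ _).
- move=> mu /= [_ nsub].
  rewrite (@down_all_local _ _ _ (fun c => \sum_(i <- [::] : seq nat) 0 * vacuum R c)).
    by rewrite (down_all_sum A [::] (fun=> 0)) big_nil mul0r.
  move=> c _; rewrite lamK => cl; rewrite big_nil /delta; case: eqP => // e.
  by exfalso; apply: nsub; rewrite /subpartition -e.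
Qed.

Lemma skewQP : is_skewQ (@skewQ R).
Proof.
have [S SP] := skewQ_exists.
rewrite /skewQ; case: xgetP => [S' _ //|/(_ S)]; by [].
Qed.

(** * The Cauchy identity by degree *)

Lemma transfer_polyC (w : bool -> bool -> bool -> bool -> R) s f b :
  transfer (fun s x m t => (w s x m t)%:P) s (fun c => (f c)%:P) b = (transfer w s f b)%:P.
Proof.
elim: b s f => [|x b IH] s f //=.
by rewrite !(IH _ (topbit f _)) !polyCD !polyCM.
Qed.

Lemma Q_state_polyC A b : Q_state (map polyC A) b = (Q_state A b)%:P.
Proof.
elim: A b => [|a A IH] b /=; first by rewrite /vacuum; case: (~~ _).
rewrite -transfer_polyC (eq_transfer _ _ (g := fun c => (Q_state A c)%:P)); last first.
  by move=> c _; exact: IH.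
congr (transfer _ _ _ _).
apply/funext => s; apply/funext => x; apply/funext => m; apply/funext => t.
by case: s x m t => [] [] [] [] /=; rewrite ?polyCM ?rmorph_nat ?polyC1 ?polyC0.
Qed.

Lemma pairing_sum (K : comNzRingType) (h : K) n f g :
  pairing h n f g = \sum_(b <- allbits n) h ^+ size (parts_of b) * (f b * g b).
Proof.
elim: n f g => [|n IH] f g /=; first by rewrite big_seq1 mul1r.
rewrite big_cat !big_map !IH mulr_sumr; congr (_ + _); apply: eq_bigr => b _ //.
by rewrite /= exprS -mulrA.
Qed.

(** The truncated geometric series in the definition of [q_fun] inverts 1 - w z modulo
    z^(n+1). *)
Lemma q_fun_prod_mod n (W : seq R) : exists r : {poly R},
  \prod_(w <- W) (1 - w *: 'X) * \prod_(w <- W) letter_poly n w =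
  \prod_(w <- W) (1 + w *: 'X) + 'X^(n.+1) * r.
Proof.
elim: W => [|w W [r IH]]; first by exists 0; rewrite !big_nil mulr0 addr0 mulr1.
have E : (1 - w *: 'X) * letter_poly n w =
    (1 + w *: 'X) + 'X^(n.+1) * - ((w ^+ n.+1) *: (1 + w *: 'X)).
  have -> : letter_poly n w = (1 + w *: 'X) * \sum_(i < n.+1) (w *: 'X) ^+ i.
    by rewrite /letter_poly poly_def; congr (_ * _); apply: eq_bigr => i _; rewrite exprZn.
  rewrite mulrCA -[(1 - _) * _]opprK -mulNr opprB -subrX1 exprZn opprB mulrBr mulr1.
  by rewrite mulrN -!scalerAr [_ * 'X^_]mulrC.
rewrite !big_cons.
exists ((1 + w *: 'X) * r - ((w ^+ n.+1) *: (1 + w *: 'X)) *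
  (\prod_(w <- W) (1 - w *: 'X) * \prod_(w <- W) letter_poly n w)).
by apply: (eq_lincomb (c := 1 + w *: 'X)
  (d := \prod_(w <- W) (1 - w *: 'X) * \prod_(w <- W) letter_poly n w) IH E); ring.
Qed.

Lemma coef_eq_mod n (p u v r : {poly R}) : p.[0] != 0 ->
  p * u - p * v = 'X^(n.+1) * r -> forall k, (k <= n)%N -> u`_k = v`_k.
Proof.
move=> p0 E k kn; apply/eqP; rewrite -subr_eq0 -coefB; apply/eqP.
have cp : coprimep 'X^(n.+1) p.
  by rewrite coprimep_expl // coprimep_sym -['X]subr0 coprimep_XsubC.
have : 'X^(n.+1) %| (u - v) by rewrite -(Gauss_dvdpr _ cp) mulrBr E dvdp_mulr.
move/dvdpP => [s ->]; by rewrite coefMXn ltnS kn.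
Qed.

(** Both sides become the product of the 1 + a y z once multiplied by the product of the
    1 - a y z, modulo z^(n+1); the latter product is invertible as a power series. *)
Lemma cauchy_graded A Y n :
  \sum_(lam <- bounded_strict n | sumn lam == n) schurQ lam A * schurP lam Y =
  q_fun n [seq a * y | y <- Y, a <- A].
Proof.
have h1 : 2 * (2^-1)%:P = 1 :> {poly R}.
  by rewrite -polyCMn -polyCM mulfV ?pnatr_eq0.
have [r E] := @cauchy_mod _ _ 'X (map polyC A) (map polyC Y) n h1.
have [r' E'] := q_fun_prod_mod n [seq a * y | y <- Y, a <- A].
rewrite -(coef_letter_prod _ (leqnn n)).
rewrite (@coef_eq_mod n (\prod_(w <- [seq a * y | y <- Y, a <- A]) (1 - w *: 'X)) _
  (pairing (2^-1)%:P n (Q_state [seq 'X * a | a <- map polyC A])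
     (Q_state (map polyC Y))) (r' - r)) //.
- rewrite pairing_sum coef_sum big_map big_mkcond /=; apply: eq_bigr => b _.
  rewrite Q_state_scale !Q_state_polyC -polyC_exp.
  rewrite (_ : _ * (_ * _) = (2^-1 ^+ size (parts_of b) *
    (Q_state A b * Q_state Y b))%:P * 'X^(bits_weight b)); last first.
    by rewrite !polyCM; ring.
  rewrite coefCM coefXn /bits_weight eq_sym; case: eqP => _; last by rewrite mulr0.
  rewrite mulr1 /schurP !(@schurQ_bits _ (strict_of_bits b) _ b) // !Q_bits_state /= exprVn.
  by ring.
- rewrite horner_prod big1 ?oner_eq0 // => w _.
  by rewrite horner_coef0 coefB coef1 coefZ coefX mulr0 subr0.
- have P (F : {poly R} -> {poly R}) : \prod_(w <- [seq a * y | y <- Y, a <- A]) F (w *: 'X) =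
    \prod_(y <- [seq i%:P | i <- Y]) \prod_(a <- [seq i%:P | i <- A]) F ('X * a * y).
    rewrite big_allpairs_dep big_map; apply: eq_bigr => y _; rewrite big_map; apply: eq_bigr => a _.
    by congr F; rewrite -mul_polyC polyCM; ring.
  rewrite E' (P (fun v => 1 - v)) (P (fun v => 1 + v)) E; ring.
Qed.

End SchurQ.

(** * The joint law of the two sizes *)

Section PairLaw.
Variable R : realType.
Implicit Types (A B X Y : seq R) (mu lam : strict_partition).

Lemma schurQ_scale mu c A : schurQ mu (scale_alphabet c A) = c ^+ sumn mu * schurQ mu A.
Proof.
have muK : parts_of (bits_of (sumn mu) mu) = mu.
  by apply: bits_ofK; [case: (mu)|exact: nth_sumn].
rewrite !(schurQ_bits _ muK) !Q_bits_state Q_state_scale.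
by rewrite /bits_weight muK.
Qed.

Lemma skewQ_sum lam A B n : (sumn lam <= n)%N ->
  schurQ lam (A ++ B) =
  \sum_(mu <- bounded_strict n | `[< subpartition mu lam >]) skewQ lam mu A * schurQ mu B.
Proof.
move=> ln; rewrite skewQP (@fsbig_fwiden _ _ _ _
  [seq mu <- bounded_strict n | `[< subpartition mu lam >]]).
- by rewrite big_filter.
- move=> mu /= sub; rewrite mem_filter; apply/andP; split; first exact/asboolP.
  by apply: mem_bounded_strict; apply: leq_trans ln; apply: leq_trans (sub 0%N) (nth_sumn _ _).
- by rewrite filter_uniq ?uniq_bounded_strict.
- by move=> mu /= [] /=; rewrite mem_filter => /andP[/asboolP].
Qed.

Lemma poly_eq_fun (p r : {poly R}) : (forall t, p.[t] = r.[t]) -> p = r.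
Proof.
move=> pr; apply/eqP; rewrite -subr_eq0; apply/negPn/negP => d0.
have := max_poly_roots (rs := [seq i%:R | i <- iota 0 (size (p - r))]) d0.
rewrite size_map size_iota ltnn => h; apply/notF/h.
  by apply/allP => z _; rewrite rootE hornerD hornerN pr subrr.
by rewrite map_inj_uniq ?iota_uniq // => i j /eqP; rewrite eqr_nat => /eqP.
Qed.

Definition products A Y : seq R := [seq a * y | y <- Y, a <- A].

Lemma q_fun_products_cat n A t Y :
  q_fun n (products (A ++ scale_alphabet t A) Y) =
  \sum_(k < n.+1) t ^+ k * (q_fun k (products A Y) * q_fun (n - k) (products A Y)).
Proof.
have -> : q_fun n (products (A ++ scale_alphabet t A) Y) =
   q_fun n (scale_alphabet t (products A Y) ++ products A Y).
  apply: perm_q_fun; rewrite perm_sym perm_catC perm_sym.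
  rewrite /products perm_allpairs_catr perm_cat2l /scale_alphabet map_allpairs allpairs_mapr.
  have -> : [seq t * (a * y) | y <- Y, a <- A] = [seq t * a * y | y <- Y, a <- A].
    by apply: eq_allpairs => y a; rewrite mulrA.
  by [].
by rewrite q_fun_cat; apply: eq_bigr => k _; rewrite q_fun_scale mulrA.
Qed.

(** Both sides are the coefficient of t^k in q_n of (X + tX) Y: the right-hand side from the
    product of generating functions, the left-hand side from the Cauchy identity and the
    definition of skew functions. *)
Lemma graded_pair_sum A Y k n : (k <= n)%N ->
  \sum_(lam <- bounded_strict n | sumn lam == n)
    \sum_(mu <- bounded_strict n | `[< subpartition mu lam >] && (sumn mu == k))
      schurQ mu A * skewQ lam mu A * schurP lam Y =
  q_fun k (products A Y) * q_fun (n - k) (products A Y).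
Proof.
pose S i := \sum_(lam <- bounded_strict n | sumn lam == n)
    \sum_(mu <- bounded_strict n | `[< subpartition mu lam >] && (sumn mu == i))
      schurQ mu A * skewQ lam mu A * schurP lam Y.
pose W i := q_fun i (products A Y) * q_fun (n - i) (products A Y).
rewrite -/(S k) -/(W k) => kn.
have E : \poly_(i < n.+1) S i = \poly_(i < n.+1) W i.
  apply: poly_eq_fun => t; rewrite !horner_poly.
  transitivity (q_fun n (products (A ++ scale_alphabet t A) Y)); last first.
    by rewrite q_fun_products_cat; apply: eq_bigr => i _; rewrite mulrC.
  rewrite -cauchy_graded.
  under eq_bigr do rewrite mulr_suml.
  rewrite exchange_big /=; apply: eq_bigr => lam /eqP ln.
  rewrite (@skewQ_sum _ _ _ n) ?ln // mulr_suml.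
  rewrite (partition_big (fun mu => inord (sumn mu) : 'I_n.+1) predT) //=.
  apply: eq_bigr => i _; rewrite mulr_suml; apply: eq_big => mu.
    case: asboolP => //= sub; rewrite -val_eqE /= inordK // ltnS -ln.
    exact: sumn_subparts.
  move=> /andP[_ /eqP <-]; rewrite schurQ_scale; ring.
by have := congr1 (fun p : {poly R} => p`_k) E; rewrite !coef_poly ltnS kn.
Qed.

Lemma pair_law_sum q X Y k m :
  \sum_(lam <- bounded_strict (k + m) | sumn lam == (k + m)%N)
    \sum_(mu <- bounded_strict (k + m) | sumn mu == k) pair_law q X Y mu lam =
  q ^+ k * (q_fun k (products X Y) * q_fun m (products X Y))
    / (cauchyH (scale_alphabet q X) Y * cauchyH X Y).
Proof.
have := graded_pair_sum X Y (leq_addr m k); rewrite addKn => <-.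
rewrite mulr_sumr mulr_suml; apply: eq_bigr => lam _.
rewrite mulr_sumr mulr_suml.
rewrite [RHS]big_mkcondl /=; apply: eq_bigr => mu /eqP mk.
rewrite /pair_law; case: ifP => // _; rewrite schurQ_scale mk.
by rewrite !mulrA.
Qed.

End PairLaw.

(** * Coefficients of a power of (1 + cz) / (1 - cz) *)

Section NegativeBinomialConvolution.
Variable R : realType.

Definition binom_conv L k : nat :=
  (\sum_(0 <= j < (minn L k).+1) 'C(L, j) * 'C(L + k - j - 1, k - j))%N.

Lemma coef_geom_exp (c : R) n L i : (i <= n)%N ->
  ((\poly_(j < n.+1) c ^+ j) ^+ L)`_i = ('C(L + i - 1, i))%:R * c ^+ i.
Proof.
elim: L i => [|L IH] i im.
  by rewrite expr0 coef1 add0n; case: i im => [|i] _; rewrite ?mulr1 // bin_small ?mul0r // subn1.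
rewrite exprSr coefM.
rewrite (eq_bigr (fun j : 'I_i.+1 => ('C(L + j - 1, j))%:R * c ^+ i)); last first.
  move=> j _; have ji : (j <= i)%N by rewrite -ltnS.
  rewrite IH ?(leq_trans ji) // coef_poly ltnS (leq_trans (leq_subr _ _)) //.
  by rewrite -mulrA -exprD subnKC.
rewrite -mulr_suml -natr_sum addSn subn1; congr (_%:R * _).
elim: i {im} => [|i IHi]; first by rewrite big_ord1 !bin0.
by rewrite big_ord_recr /= IHi addnS subn1 binS addnC.
Qed.

Lemma q_fun_nseq k L (c : R) : q_fun k (nseq L c) = c ^+ k * (binom_conv L k)%:R.
Proof.
have geomN n : \prod_(a <- nseq L c) letter_poly n a =
    (1 + c *: 'X) ^+ L * (\poly_(j < n.+1) c ^+ j) ^+ L.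
  by rewrite big_nseq -[iter _ _ _]Monoid.iteropE -exprMn.
have binomE j : ((1 + c *: 'X) ^+ L)`_j = 'C(L, j)%:R * c ^+ j.
  have term (i : 'I_L.+1) : (1 ^+ (L - i) * (c *: 'X) ^+ i *+ 'C(L, i))`_j =
      (j == i)%:R * ('C(L, j)%:R * c ^+ j) :> R.
    rewrite expr1n mul1r exprZn coefMn coefZ coefXn.
    by case: eqP => [->|_] /=; rewrite ?mulr1 ?mul1r ?mulr0 ?mul0r ?mul0rn // mulr_natl.
  rewrite exprDn coef_sum (eq_bigr _ (fun i _ => term i)).
  have [jL|Lj] := leqP j L.
    rewrite (bigD1 (Ordinal (jL : (j < L.+1)%N))) //= eqxx mul1r big1 ?addr0 // => i ij.
    case: eqP => [e|]; last by rewrite mul0r.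
    by move: ij; rewrite -val_eqE /= -e eqxx.
  by rewrite bin_small // !mul0r big1 // => i _; rewrite mulr0.
rewrite -(coef_letter_prod _ (leqnn k)) geomN coefM mulr_natr -mulr_natl.
have -> : binom_conv L k = (\sum_(0 <= j < k.+1) 'C(L, j) * 'C(L + k - j - 1, k - j))%N.
  rewrite /binom_conv; have [Lk|kL //] := leqP L k.
  rewrite [RHS](@big_cat_nat _ _ _ L.+1) //=.
  rewrite (_ : \sum_(L.+1 <= j < k.+1) _ = 0)%N ?addn0 //.
  by rewrite big_nat_cond big1 // => j /andP[/andP[Lj _] _]; rewrite bin_small.
rewrite natr_sum mulr_suml big_mkord; apply: eq_bigr => j _.
have jk : (j <= k)%N by rewrite -ltnS.
rewrite binomE coef_geom_exp ?leq_subr // natrM addnBA //.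
have -> : c ^+ k = c ^+ j * c ^+ (k - j) by rewrite -exprD subnKC.
by ring.
Qed.

Lemma products_nseq M N (x y : R) : products (nseq M x) (nseq N y) = nseq (M * N) (x * y).
Proof.
rewrite /products mulnC; elim: N => [|N IH] //=.
by rewrite mulSn nseqD -IH; congr cat; rewrite map_nseq.
Qed.

Lemma q_fun_nseq_step L (c : R) n :
  q_fun n.+1 (nseq L.+1 c) =
  c * q_fun n (nseq L.+1 c) + q_fun n.+1 (nseq L c) + c * q_fun n (nseq L c).
Proof.
have := shifted_q_fun c (nseq L c) n.+1; rewrite /shifted -[c :: nseq L c]/(nseq L.+1 c) => E.
by apply: (eq_lincomb (c := 1) (d := 0) E E); ring.
Qed.

(** Coefficients of (1 - c^2 z^2) f' = 2 L c f for f = ((1 + c z) / (1 - c z))^L; the first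
    statement is the coefficient of z^0. The induction on L multiplies the equation for L by
    1 + c z and divides by 1 - c z. *)
Lemma q_fun_nseq_rec L (c : R) :
  q_fun 1 (nseq L c) = 2 * L%:R * c /\
  forall n, n.+2%:R * q_fun n.+2 (nseq L c) =
    c ^+ 2 * n%:R * q_fun n (nseq L c) + 2 * L%:R * c * q_fun n.+1 (nseq L c).
Proof.
elim: L => [|L [IH1 IH2]].
  split=> [|n]; rewrite !q_fun_nil //=; first by ring.
  by case: n => [|n] /=; ring.
have u1 : q_fun 1 (nseq L.+1 c) = 2 * L.+1%:R * c.
  by rewrite q_fun_nseq_step !q_fun0 IH1 -natr1; ring.
split=> //.
elim=> [|n IHn].
  have := IH2 0%N; rewrite IH1 => E.
  apply: (eq_lincomb (c := 1) (d := 0) E E).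
  rewrite (q_fun_nseq_step L c 1) u1 !IH1 !q_fun0 -!natr1; ring.
have E := IH2 n.+1; have E' := IH2 n.
apply: (eq_lincomb (c := 1) (d := c) (congr2 (fun z z' => z + c * z') E E') IHn).
rewrite (q_fun_nseq_step L c n.+2) (q_fun_nseq_step L c n.+1) (q_fun_nseq_step L c n).
rewrite -!natr1; ring.
Qed.

End NegativeBinomialConvolution.

(** * Sums of the coefficients and their moments *)

Section Limits.
Variable R : realType.

(** A nondecreasing sequence with W_(n+j) - d W_n convergent is bounded, because
    (1 - d) W_n is at most W_(n+j) - d W_n; so it converges, and its limit solves the
    limiting equation. All sums below satisfy such a recursion, with d = c or d = c^2. *)
Lemma cvg_geometric_recursion (W l : nat -> R) (d z : R) (j : nat) :
  0 <= d < 1 -> {homo W : m n / (m <= n)%N >-> m <= n} ->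
  (forall n, W (n + j)%N - d * W n = l n) ->
  l @ \oo --> z -> W @ \oo --> z / (1 - d).
Proof.
move=> /andP[d0 d1] Wn Wl lz.
have d1' : 0 < 1 - d by rewrite subr_gt0.
have [M lM] : exists M, forall n, l n <= M.
  have [M0 [_ lM]] : bounded_fun l by apply: cvg_seq_bounded; apply/cvg_ex; exists z.
  exists (M0 + 1) => n; apply: le_trans (ler_norm _) _.
  by apply: (lM (M0 + 1) _ n I); rewrite ltrDl.
have cW : cvg (W @ \oo).
  apply: nondecreasing_is_cvgn => //; exists (M / (1 - d)) => _ [n _ <-].
  rewrite ler_pdivlMr // mulrBr mulr1 mulrC; apply: le_trans (lM n); rewrite -Wl lerD2r.
  by apply: Wn; rewrite leq_addr.
have cWj : (fun n => W (n + j)%N) @ \oo --> limn W by rewrite cvg_shiftn.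
have h : (fun n => W (n + j)%N - d * W n) @ \oo --> limn W - d * limn W.
  by apply: cvgB => //; apply: cvgMl_tmp.
have e : limn W - d * limn W = z.
  apply: (cvg_unique _ h) => //.
  by rewrite (_ : (fun n => _) = l) //; apply/funext => n; rewrite Wl.
have -> : z / (1 - d) = limn W by rewrite -e; field; rewrite gt_eqF.
exact: cW.
Qed.

Variables (L : nat) (c : R).
Hypothesis c01 : 0 <= c < 1.

Notation u := (fun k => q_fun k (nseq L c)).

Lemma q_fun_nseq_ge0 L' k : 0 <= q_fun k (nseq L' c).
Proof.
by case/andP: c01 => c0 _; rewrite q_fun_nseq mulr_ge0 ?exprn_ge0 ?ler0n.
Qed.

Lemma cvg_succ (w : nat -> R) (z : R) :
  w @ \oo --> z -> (fun n => w n.+1) @ \oo --> z.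
Proof. by rewrite -(cvg_shiftS w). Qed.

Lemma nondecreasing_psum (w : nat -> R) : (forall k, 0 <= w k) ->
  {homo (fun n => \sum_(0 <= k < n) w k) : m n / (m <= n)%N >-> m <= n}.
Proof.
move=> w0 m n mn; rewrite (@big_cat_nat _ _ _ m 0 n) //= lerDl; exact: sumr_ge0.
Qed.

Lemma cvg_q_fun_sum :
  (fun n => \sum_(0 <= k < n) u k) @ \oo --> ((1 + c) / (1 - c)) ^+ L.
Proof.
elim: L => [|L' IH].
  rewrite expr0 -cvg_shiftS.
  apply: cvg_near_cst; apply: nearW => n /=.
  by rewrite big_nat_recl // q_fun0 big1 ?addr0 // => k _; rewrite q_fun_nil.
pose V n := \sum_(0 <= k < n) q_fun k (nseq L' c).
have cV : V @ \oo --> ((1 + c) / (1 - c)) ^+ L' := IH.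
rewrite (_ : _ ^+ L'.+1 =
  (((1 + c) / (1 - c)) ^+ L' + c * ((1 + c) / (1 - c)) ^+ L') / (1 - c)); last first.
  by rewrite exprS; ring.
apply: (@cvg_geometric_recursion _ (fun n => V n.+1 + c * V n) c _ 1) => //.
- by apply: nondecreasing_psum => k; exact: q_fun_nseq_ge0.
- move=> n; rewrite addn1 /V !big_nat_recl // !q_fun0.
  rewrite [X in _ + X - _](eq_bigr (fun i => c * q_fun i (nseq L'.+1 c) +
    (q_fun i.+1 (nseq L' c) + c * q_fun i (nseq L' c)))) => [|i _]; last first.
    by rewrite q_fun_nseq_step addrA.
  rewrite !big_split /= -!mulr_sumr; ring.
- by apply: cvgD; [exact: (@cvg_succ _ _ cV)|apply: cvgMl_tmp].
Qed.

Let S := ((1 + c) / (1 - c)) ^+ L.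
Let m := 2 * L%:R * c / (1 - c ^+ 2).

Lemma c2_01 : 0 <= c ^+ 2 < 1.
Proof. by case/andP: c01 => c0 c1; rewrite exprn_ge0 //= expr_lt1. Qed.

Lemma cvg_q_fun_mean :
  (fun n => \sum_(0 <= k < n) k%:R * u k) @ \oo --> m * S.
Proof.
rewrite (_ : m * S = (2 * L%:R * c * S) / (1 - c ^+ 2)); last by rewrite /m; ring.
apply: (@cvg_geometric_recursion _ (fun n => 2 * L%:R * c * \sum_(0 <= k < n.+1) u k) _ _ 2) => //.
- exact: c2_01.
- by apply: nondecreasing_psum => k; rewrite mulr_ge0 ?q_fun_nseq_ge0.
- move=> n; rewrite addn2 big_nat_recl // big_nat_recl // [in RHS]big_nat_recl //.
  have [u1 urec] := q_fun_nseq_rec L c.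
  rewrite (eq_bigr (fun i => c ^+ 2 * (i%:R * q_fun i (nseq L c)) +
     2 * L%:R * c * q_fun i.+1 (nseq L c))) => [|i _]; last by rewrite urec mulrA.
  rewrite big_split /= -!mulr_sumr u1 q_fun0; ring.
- by apply: cvgMl_tmp; exact: (@cvg_succ _ _ cvg_q_fun_sum).
Qed.

Lemma cvg_q_fun_square :
  (fun n => \sum_(0 <= k < n) k%:R ^+ 2 * u k) @ \oo -->
     (2 * c ^+ 2 * m + 2 * L%:R * c * (m + 1)) / (1 - c ^+ 2) * S.
Proof.
rewrite mulrAC.
rewrite (_ : _ * S = 2 * c ^+ 2 * (m * S) + 2 * L%:R * c * (m * S + S)); last by ring.
apply: (@cvg_geometric_recursion _ (fun n => 2 * c ^+ 2 * (\sum_(0 <= k < n) k%:R * u k) +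
  2 * L%:R * c * (\sum_(0 <= k < n.+1) k%:R * u k + \sum_(0 <= k < n.+1) u k)) _ _ 2) => //.
- exact: c2_01.
- by apply: nondecreasing_psum => k; rewrite mulr_ge0 ?q_fun_nseq_ge0 ?exprn_ge0.
- move=> n; rewrite addn2 big_nat_recl // big_nat_recl //.
  rewrite [\sum_(0 <= k < n.+1) _]big_nat_recl // [\sum_(0 <= k < n.+1) q_fun _ _]big_nat_recl //.
  have [u1 urec] := q_fun_nseq_rec L c.
  rewrite (eq_bigr (fun i => c ^+ 2 * (i%:R ^+ 2 * q_fun i (nseq L c)) +
     (2 * c ^+ 2 * (i%:R * q_fun i (nseq L c)) +
     (2 * L%:R * c * (i.+1%:R * q_fun i.+1 (nseq L c)) +
      2 * L%:R * c * q_fun i.+1 (nseq L c))))) => [|i _]; last first.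
    rewrite expr2 -mulrA urec -!natr1; ring.
  rewrite !big_split /= -!mulr_sumr u1 q_fun0; ring.
- apply: cvgD; first by apply: cvgMl_tmp; exact: cvg_q_fun_mean.
  apply: cvgMl_tmp; apply: cvgD; first exact: (@cvg_succ _ _ cvg_q_fun_mean).
  exact: (@cvg_succ _ _ cvg_q_fun_sum).
Qed.

Lemma cvg_q_fun_variance :
  (fun n => \sum_(0 <= k < n) (k%:R - m) ^+ 2 * u k) @ \oo -->
     2 * L%:R * c * (1 + c ^+ 2) / (1 - c ^+ 2) ^+ 2 * S.
Proof.
rewrite (_ : _ * S = (2 * c ^+ 2 * m + 2 * L%:R * c * (m + 1)) / (1 - c ^+ 2) * S
   - 2 * m * (m * S) + m ^+ 2 * S); last first.
  rewrite /m; field; have /andP[_ c2] := c2_01; by rewrite subr_eq0 gt_eqF.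
have -> : (fun n => \sum_(0 <= k < n) (k%:R - m) ^+ 2 * u k) =
  (fun n => \sum_(0 <= k < n) k%:R ^+ 2 * u k
  - 2 * m * (\sum_(0 <= k < n) k%:R * u k) + m ^+ 2 * \sum_(0 <= k < n) u k).
  apply/funext => n; rewrite !mulr_sumr -sumrB -big_split /=; apply: eq_bigr => k _; ring.
apply: cvgD; last by apply: cvgMl_tmp; exact: cvg_q_fun_sum.
apply: cvgB; first exact: cvg_q_fun_square.
by apply: cvgMl_tmp; exact: cvg_q_fun_mean.
Qed.

End Limits.

(** * Discrete laws *)

Section DiscreteProbability.
Context d (T : measurableType d) (R : realType) (P : probability T R).
Variables (E : nat -> set T) (r : nat -> R).
Hypotheses (mE : forall k, measurable (E k)) (tE : trivIset [set: nat] E)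
  (PE : forall k, P (E k) = (r k)%:E).

Lemma probability_bigcup (z : R) : (fun n => \sum_(0 <= k < n) r k) @ \oo --> z ->
  P (\bigcup_k E k) = z%:E.
Proof.
move=> rz.
have h : (fun n => (\sum_(0 <= k < n) P (E k))%E) @ \oo --> P (\bigcup_k E k).
  by apply: (measure_semi_sigma_additive (s := P)) => //; exact: bigcup_measurable.
apply: (cvg_unique _ h) => //.
rewrite (_ : (fun n => _) = (fun n => (\sum_(0 <= k < n) r k)%:E)).
  by apply/fine_cvgP; split => //; exact: nearW.
by apply/funext => n; rewrite -sumEFin; apply: eq_bigr => k _; rewrite PE.
Qed.

(** The events [E k] have total probability 1, so [h] may be replaced by 0 off their union;
    the function so obtained is nonnegative and can be integrated piece by piece. *)
Lemma integral_discrete (h : T -> R) (w : nat -> R) (z : R) :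
  (fun n => \sum_(0 <= k < n) r k) @ \oo --> (1 : R) ->
  measurable_fun [set: T] h -> (forall k x, E k x -> h x = w k) -> (forall k, 0 <= w k) ->
  (fun n => \sum_(0 <= k < n) w k * r k) @ \oo --> z ->
  (\int[P]_x (h x)%:E = z%:E)%E.
Proof.
move=> r1 mh hw w0 wz.
set U := \bigcup_k E k.
have mU : measurable U by exact: bigcup_measurable.
have PU : P (~` U) = 0%E by rewrite probability_setC // (probability_bigcup r1) subee.
pose H : T -> \bar R := EFin \o h.
have mEh : measurable_fun [set: T] H by apply/measurable_EFinP.
have mhU : measurable_fun [set: T] (H \_ U).
  apply/(measurable_restrict _ _ _).1 => //; exact: measurable_funS mEh.
rewrite (@ae_eq_integral _ _ _ P setT (H \_ U)) //; last first.
  exists (~` U); split => //; first exact: measurableC.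
  move=> x /= nx Ux; apply: nx => _.
  by rewrite patchE mem_set.
rewrite -integral_mkcond ge0_integral_bigcup //.
- have e k : (\int[P]_(x in E k) H x = (w k * r k)%:E)%E.
    rewrite (eq_integral (cst (w k)%:E)); last first.
      by move=> x /set_mem xE; rewrite /H /= (hw _ _ xE).
    transitivity ((w k)%:E * P (E k))%E; first exact: integral_cst.
    by rewrite PE.
  rewrite (eq_eseriesr (g := fun k => (w k * r k)%:E)) => [|k _]; last exact: e.
  apply/cvg_lim => //.
  rewrite (_ : (fun n => _) = (fun n => (\sum_(0 <= k < n) w k * r k)%:E)).
    by apply/fine_cvgP; split => //; exact: nearW.
  by apply/funext => n; rewrite -sumEFin.
- exact: measurable_funS mEh.
- by move=> x [k _ xE]; rewrite /H /= (hw _ _ xE) lee_fin.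
Qed.

End DiscreteProbability.

Section FiniteSets.
Context d (T : measurableType d) (R : realType) (P : probability T R).

(** Strict partitions are countable, and points are measurable. *)
Lemma measurable_pairs (A : set (strict_partition * strict_partition)) : measurable A.
Proof.
apply: countable_measurable; last exact: countableP.
move=> [mu lam]; rewrite (_ : [set _] = [set mu] `*` [set lam]); first exact: measurableX.
by apply/seteqP; split => [_ -> //|[a b] /= [-> ->]].
Qed.

Variable Z : {RV P >-> (strict_partition * strict_partition)%type}.

Lemma measurable_event (A : set (strict_partition * strict_partition)) :
  measurable (Z @^-1` A).
Proof.
rewrite -[X in measurable X]setTI.
by apply: measurable_funPT => //; exact: measurable_pairs.
Qed.

Variable f : strict_partition -> strict_partition -> R.
Hypothesis Zf : forall mu lam, distribution P Z [set (mu, lam)] = (f mu lam)%:E.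

Lemma probability_sizes k n N : (k <= N)%N -> (n <= N)%N ->
  P [set w | sumn (Z w).1 = k /\ sumn (Z w).2 = n] =
  (\sum_(lam <- bounded_strict N | sumn lam == n)
    \sum_(mu <- bounded_strict N | sumn mu == k) f mu lam)%:E.
Proof.
move=> kN nN.
pose s := [seq (mu, lam) | lam <- [seq lam : strict_partition <- bounded_strict N | sumn lam == n],
   mu <- [seq mu : strict_partition <- bounded_strict N | sumn mu == k]].
have us : uniq s.
  apply: allpairs_uniq; rewrite ?filter_uniq ?uniq_bounded_strict //.
  by move=> [a b] [a' b'] _ _ /= [-> ->].
have -> : [set w | sumn (Z w).1 = k /\ sumn (Z w).2 = n] =
   Z @^-1` (\bigcup_(p in [set` s]) [set p]).
  apply/seteqP; split => w /=.
    move=> [wk wn]; exists (Z w) => //=; apply/allpairsP; exists ((Z w).2, (Z w).1) => /=.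
    rewrite !mem_filter wk wn !eqxx -surjective_pairing; split => //=.
      by apply: mem_bounded_strict; apply: leq_trans nN; rewrite -wn nth_sumn.
    by apply: mem_bounded_strict; apply: leq_trans kN; rewrite -wk nth_sumn.
  move=> [p /= /allpairsP[[lam mu] /= [+ + pE]] ->]; rewrite {}pE !mem_filter /=.
  by move=> /andP[/eqP -> _] /andP[/eqP -> _].
rewrite -[LHS]/(distribution P Z _) measure_fin_bigcup //; last 3 first.
- exact: finite_seq.
- by move=> p q _ _ /= [t [-> ->]].
- by move=> p _; exact: measurable_pairs.
rewrite -fsbig_seq // big_allpairs_dep big_filter -sumEFin; apply: eq_bigr => lam _.
by rewrite big_filter -sumEFin; apply: eq_bigr => mu _; exact: Zf.
Qed.

End FiniteSets.

Section JointLaw.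
Context d (T : measurableType d) (R : realType) (P : probability T R).
Variables (Z : {RV P >-> (strict_partition * strict_partition)%type}) (q : R) (X Y : seq R).
Hypothesis ZE : forall mu lam, distribution P Z [set (mu, lam)] = (pair_law q X Y mu lam)%:E.

Lemma joint_size_law k m :
  P [set w | sumn (Z w).1 = k /\ sumn (Z w).2 = (k + m)%N] =
  (q ^+ k * (q_fun k (products X Y) * q_fun m (products X Y))
    / (cauchyH (scale_alphabet q X) Y * cauchyH X Y))%:E.
Proof. by rewrite (probability_sizes ZE (leq_addr m k) (leqnn _)) pair_law_sum. Qed.

(** The pair law vanishes unless mu is contained in lambda. *)
Lemma joint_size_law0 k n : (n < k)%N ->
  P [set w | sumn (Z w).1 = k /\ sumn (Z w).2 = n] = 0%E.
Proof.
move=> nk; rewrite (probability_sizes ZE (leqnn k) (ltnW nk)); congr EFin.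
apply: big1 => lam /eqP ln; apply: big1 => mu /eqP mk.
by rewrite /pair_law; case: asboolP => // /sumn_subparts; rewrite ln mk leqNgt nk.
Qed.

End JointLaw.

(** * Marginals of a product law *)

Section ProductForm.
Context d (T : measurableType d) (R : realType) (P : probability T R).
Variables (f g : T -> nat) (u v : nat -> R) (U V C : R).
Hypotheses
  (mfg : forall k n, measurable [set w | f w = k /\ g w = n])
  (Pfg : forall k m, P [set w | f w = k /\ g w = (k + m)%N] = (u k * v m * C)%:E)
  (Pfg0 : forall k n, (n < k)%N -> P [set w | f w = k /\ g w = n] = 0%E)
  (uU : (fun n => \sum_(0 <= k < n) u k) @ \oo --> U)
  (vV : (fun n => \sum_(0 <= k < n) v k) @ \oo --> V).

Let fibre k : [set w | f w = k] = \bigcup_n [set w | f w = k /\ g w = n].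
Proof.
by apply/seteqP; split => [w /= <-|w [n _ [/=]]//]; exists (g w).
Qed.

Let cvg_scale (w : nat -> R) (z s t : R) :
  (fun n => \sum_(0 <= k < n) w k) @ \oo --> z ->
  (fun n => \sum_(0 <= k < n) s * w k * t) @ \oo --> s * z * t.
Proof.
move=> wz; have -> : (fun n => \sum_(0 <= k < n) s * w k * t) =
  (fun n => s * (\sum_(0 <= k < n) w k) * t).
  by apply/funext => n; rewrite mulr_sumr mulr_suml.
by apply: cvgMr_tmp; apply: cvgMl_tmp.
Qed.

Let first_law k : P [set w | f w = k] = (u k * V * C)%:E.
Proof.
rewrite fibre.
(* [r n] is the probability of [f = k, g = n]; it is 0 for n < k. *)
pose r n := if (k <= n)%N then u k * v (n - k)%N * C else 0.
apply: (@probability_bigcup _ _ _ _ _ r) => //.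
- by move=> i j _ _ [w [[_ <-] [_ <-]]].
- move=> n; rewrite /r; case: leqP => kn; last exact: Pfg0.
  by rewrite -[in X in P X](subnKC kn) Pfg.
- rewrite -(cvg_shiftn k) /=.
  have -> : (fun n => \sum_(0 <= i < n + k) r i) =
      (fun n => \sum_(0 <= m < n) u k * v m * C).
    apply/funext => n; rewrite (@big_cat_nat _ _ _ k 0) ?leq_addl //=.
    rewrite [X in X + _]big_nat_cond big1 ?add0r; last first.
      by move=> i /andP[/andP[_ ik] _]; rewrite /r leqNgt ik.
    rewrite -{1}[k]add0n big_addn addnK; apply: eq_bigr => i _.
    by rewrite /r leq_addl addnK.
  exact: cvg_scale.
Qed.

Let mass : U * V * C = 1.
Proof.
apply: EFin_inj; rewrite -(@probability_setT _ _ _ P).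
rewrite (_ : setT = \bigcup_k [set w | f w = k]); last first.
  by apply/seteqP; split => w // _; exists (f w).
apply/esym; apply: (@probability_bigcup _ _ _ _ _ (fun k => u k * V * C)) => //.
- by move=> k; rewrite fibre; exact: bigcup_measurable.
- by move=> i j _ _ [w [/= <- <-]].
- rewrite -mulrA -[U]mul1r.
  have -> : (fun n => \sum_(0 <= k < n) u k * V * C) =
     (fun n => \sum_(0 <= k < n) 1 * u k * (V * C)).
    by apply/funext => n; apply: eq_bigr => k _; rewrite mul1r mulrA.
  exact: cvg_scale.
Qed.

(** Summing over the other variable gives the marginals up to the factors V C and U C. The
    probabilities of the events f = k sum to 1, and this says that U V C = 1. *)
Lemma product_form_marginals :
  (forall k, P [set w | f w = k] = (u k / U)%:E) /\
  (forall m, P [set w | g w = (f w + m)%N] = (v m / V)%:E).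
Proof.
have [U0 V0] : U != 0 /\ V != 0.
  have : U * V * C != 0 by rewrite mass oner_eq0.
  by rewrite !mulf_eq0 !negb_or => /andP[/andP[]].
split=> [k|m].
  by rewrite first_law; congr EFin; rewrite -[u k in RHS]mulr1 -mass; field.
have -> : [set w | g w = (f w + m)%N] =
    \bigcup_k [set w | f w = k /\ g w = (k + m)%N].
  by apply/seteqP; split => [w /= gw|w [k _ [/= -> ->]]//]; exists (f w).
have -> : v m / V = 1 * U * (v m * C).
  by rewrite mul1r -[v m in LHS]mulr1 -mass; field.
apply: (@probability_bigcup _ _ _ _ _ (fun k => 1 * u k * (v m * C))) => //.
- by move=> i j _ _ [w [[<- _] [<- _]]].
- by move=> k; rewrite Pfg mul1r mulrA.
- exact: cvg_scale.
Qed.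

End ProductForm.

(** * Mean and variance *)

Section Moments.
Context d (T : measurableType d) (R : realType) (P : probability T R).
Variables (X : T -> R) (L : nat) (c : R).
Hypotheses (c01 : 0 <= c < 1) (mX : measurable_fun [set: T] X).
Let S := ((1 + c) / (1 - c)) ^+ L.
Hypothesis PX : forall k : nat, P [set w | X w = k%:R] = (q_fun k (nseq L c) / S)%:E.

(** The variance is the expectation of (X - m)^2 for the mean m. This is again a nonnegative
    function of the value of X, so the summation formula used for the mean applies to it. *)
Lemma moments_of_law :
  ('E_P[X] = (2 * L%:R * c / (1 - c ^+ 2))%:E)%E /\
  ('V_P[X] = (2 * L%:R * c * (1 + c ^+ 2) / (1 - c ^+ 2) ^+ 2)%:E)%E.
Proof.
have S0 : S != 0.
  have /andP[c0 c1] := c01.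
  by rewrite expf_neq0 // mulf_neq0 ?invr_eq0 //; apply: lt0r_neq0; lra.
pose E k := [set w | X w = k%:R].
have mE k : measurable (E k) by rewrite -[E k]setTI; apply: (mX measurableT (measurable_set1 k%:R)).
have tE : trivIset [set: nat] E.
  by move=> i j _ _ [w []]; rewrite /E /= => -> /eqP; rewrite eqr_nat => /eqP.
have scale (w : nat -> R) (z : R) :
    (fun n => \sum_(0 <= k < n) w k * q_fun k (nseq L c)) @ \oo --> z * S ->
    (fun n => \sum_(0 <= k < n) w k * (q_fun k (nseq L c) / S)) @ \oo --> z.
  move=> h; rewrite -[z in X in _ --> X](mulfK S0).
  have -> : (fun n => \sum_(0 <= k < n) w k * (q_fun k (nseq L c) / S)) =
     (fun n => (\sum_(0 <= k < n) w k * q_fun k (nseq L c)) * S^-1).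
    by apply/funext => n; rewrite mulr_suml; apply: eq_bigr => k _; rewrite mulrA.
  exact: cvgMr_tmp.
have total : (fun n => \sum_(0 <= k < n) (q_fun k (nseq L c) / S)) @ \oo --> (1 : R).
  have -> : (fun n => \sum_(0 <= k < n) (q_fun k (nseq L c) / S)) =
     (fun n => \sum_(0 <= k < n) 1 * (q_fun k (nseq L c) / S)).
    by apply/funext => n; apply: eq_bigr => k _; rewrite mul1r.
  apply: scale; rewrite mul1r.
  under eq_fun do under eq_bigr do rewrite mul1r.
  exact: cvg_q_fun_sum.
have mean : ('E_P[X] = (2 * L%:R * c / (1 - c ^+ 2))%:E)%E.
  rewrite unlock; apply: (integral_discrete (w := fun k => k%:R) mE tE PX total) => //.
  - exact: scale (cvg_q_fun_mean c01).
split=> //; rewrite /variance covariance.unlock mean /= unlock.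
set m := 2 * L%:R * c / (1 - c ^+ 2).
apply: (integral_discrete (w := fun k => (k%:R - m) ^+ 2) mE tE PX total) => //.
- apply: measurable_funM; apply: measurable_funB => //.
- by move=> k w wE; have {}wE : X w = k%:R := wE; rewrite -wE expr2.
- by move=> k; exact: sqr_ge0.
- by apply: (scale (fun k => (k%:R - m) ^+ 2)); exact: cvg_q_fun_variance.
Qed.

End Moments.

Theorem proposition10p2 (R : realType) (q x y : R) (M N : nat)
  (hq : 0 <= q) (hx : 0 <= x) (hy : 0 <= y)
  (hqxy : Num.max 1 q * (x * y) < 1)
  (hM : (1 <= M)%N) (hN : (1 <= N)%N)
  (d : measure_display) (T : measurableType d) (P : probability T R)
  (Z : {RV P >-> (strict_partition * strict_partition)%type})
  (hZ : forall mu lam : strict_partition,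
    distribution P Z [set (mu, lam)] =
    (pair_law q (nseq M x) (nseq N y) mu lam)%:E) :
  let L := (M * N)%N in
  let a := q * x * y in
  let b := x * y in
  let B : T -> R := fun w => (sumn (Z w).1)%:R in
  let D : T -> R := fun w => (sumn (Z w).2)%:R - (sumn (Z w).1)%:R in
  let law : R -> nat -> R := fun c k =>
    ((1 - c) / (1 + c)) ^+ L * c ^+ k *
    (\sum_(0 <= j < (minn L k).+1)
       'C(L, j) * 'C(L + k - j - 1, k - j))%N%:R in
  [/\ forall k : nat, P [set w | B w = k%:R] = (law a k)%:E,
      ('E_P[B] = (2 * L%:R * a / (1 - a ^+ 2))%R%:E)%E
    & ('V_P[B] = (2 * L%:R * a * (1 + a ^+ 2) / (1 - a ^+ 2) ^+ 2)%R%:E)%E]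
  /\
  [/\ forall k : nat, P [set w | D w = k%:R] = (law b k)%:E,
      ('E_P[D] = (2 * L%:R * b / (1 - b ^+ 2))%R%:E)%E
    & ('V_P[D] = (2 * L%:R * b * (1 + b ^+ 2) / (1 - b ^+ 2) ^+ 2)%R%:E)%E].
Proof.
move=> L a b B D law.
have b0 : 0 <= b by rewrite mulr_ge0.
have a0 : 0 <= a by rewrite !mulr_ge0.
have aE : a = q * b by rewrite /a -mulrA.
have b01 : 0 <= b < 1.
  rewrite b0 (le_lt_trans _ hqxy) // -[b]mul1r ler_wpM2r // le_max lexx //.
have a01 : 0 <= a < 1.
  rewrite a0 (le_lt_trans _ hqxy) // aE ler_wpM2r // le_max lexx orbT //.
pose S (c : R) := ((1 + c) / (1 - c)) ^+ L.
pose u (c : R) k := q_fun k (nseq L c).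
pose C := (cauchyH (scale_alphabet q (nseq M x)) (nseq N y)
  * cauchyH (nseq M x) (nseq N y))^-1.
have ua k : u a k = q ^+ k * u b k by rewrite /u !q_fun_nseq aE exprMn mulrA.
have [PB PD] : (forall k, P [set w | sumn (Z w).1 = k] = (u a k / S a)%:E) /\
    (forall m, P [set w | sumn (Z w).2 = (sumn (Z w).1 + m)%N] = (u b m / S b)%:E).
  apply: (@product_form_marginals _ _ _ _ _ _ (u a) (u b) (S a) (S b) C).
  - move=> k n; apply: (measurable_event Z
      [set p : strict_partition * strict_partition | sumn p.1 = k /\ sumn p.2 = n]).
  - move=> k m; rewrite (joint_size_law hZ) products_nseq ua.
    by rewrite -[q ^+ k * u b k * u b m]mulrA.
  - by move=> k n; exact: joint_size_law0.
  - exact: cvg_q_fun_sum.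
  - exact: cvg_q_fun_sum.
have {}PB k : P [set w | B w = k%:R] = (u a k / S a)%:E.
  rewrite -PB; congr (P _); apply/seteqP; split => w /=; last by rewrite /B => ->.
  by move=> /eqP; rewrite eqr_nat => /eqP.
have {}PD m : P [set w | D w = m%:R] = (u b m / S b)%:E.
  rewrite -PD; congr (P _); apply/seteqP; split => w /=.
    by move=> /eqP; rewrite subr_eq -natrD eqr_nat addnC => /eqP.
  by rewrite /D => ->; rewrite natrD addrC addKr.
have mg (g : strict_partition * strict_partition -> R) : measurable_fun [set: T] (g \o Z).
  by apply: measurableT_comp => // _ V _; exact: measurable_pairs.
have mB : measurable_fun [set: T] B := mg (fun p => (sumn p.1)%:R).
have mD : measurable_fun [set: T] D := mg (fun p => (sumn p.2)%:R - (sumn p.1)%:R).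
have lawE c k : law c k = u c k / S c.
  by rewrite /law /u q_fun_nseq /S -exprVn invf_div mulrC mulrA; ring.
have [EB VB] := moments_of_law a01 mB PB.
have [ED VD] := moments_of_law b01 mD PD.
split; split => // k; first by rewrite PB lawE.
by rewrite PD lawE.
Qed.
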